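(* Let $T_0>0$, $\Theta\subseteq\mathbb{R}^K$ open, and $\theta\mapsto h_\theta$ a mapping from $\Theta$ into the real functions in $L_2[0,T_0]$ satisfying (P6) Fréchet differentiability with derivative $D_\theta=\frac{\partial h_\theta}{\partial\theta}:\mathbb{R}^K\to L_2[0,T_0]$ continuous linear, and (P7) $\mathcal{N}(D_\theta)=\{0\}$. Let $x=h_\theta$ with $\theta\in\Theta$ unknown deterministic, let $y=x+w$ with $w$ continuous-time white Gaussian noise of level $\sigma_c^2$, and let real sampling kernels $s_1,\dots,s_N\in L_2[0,T_0]$ produce measurements $c_n=\langle y,s_n\rangle+v_n$, $n=1,\dots,N$, where $v_1,\dots,v_N$ are i.i.d. $N(0,\sigma_d^2)$ independent of $w$; assume $\sigma_c^2S^*S+\sigma_d^2 I_N$ is invertible. Then the Fisher information matrix for estimating $\theta$ from $c=(c_1,\dots,c_N)^T$ is $$J^{\mathrm{samp}}_\theta=D_\theta^*\,S\,(\sigma_c^2S^*S+\sigma_d^2I_N)^{-1}S^*\,D_\theta,$$ where $S$ is the set transformation of $\{s_n\}$. If moreover $\mathcal{R}(D_\theta)\cap\mathcal{S}^\perp=\{0\}$, where $\mathcal{S}=\operatorname{span}\{s_1,\dots,s_N\}$, then $J^{\mathrm{samp}}_\theta$ is invertible and every unbiased estimator $\hat x$ of $x$ from $c$ with finite second moment satisfies $$\mathbb{E}_\theta\|\hat x-x\|_{L_2}^2\ge\operatorname{Tr}\big[D_\theta^*D_\theta\,(J^{\mathrm{samp}}_\theta)^{-1}\big].$$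
   Context: $\langle f,g\rangle=\int_0^{T_0}f(t)g^*(t)dt$. White noise $w$: for $f,g\in L_2$, $\langle f,w\rangle,\langle g,w\rangle$ are zero-mean jointly Gaussian with $\mathbb{E}[\langle f,w\rangle\langle g,w\rangle^*]=\sigma_c^2\langle f,g\rangle$. The set transformation $S:\mathbb{C}^N\to L_2$ of functions $s_1,\dots,s_N$ is $S v=\sum_n v_n s_n$, so $S^*f=(\langle f,s_1\rangle,\dots,\langle f,s_N\rangle)^T$. $\mathcal{R}$, $\mathcal{N}$ denote range and null space; unbiased means $\mathbb{E}_\theta[\hat x]=h_\theta$ for all $\theta$ (weak expectation). *)

(* Defs.v *)
From HB Require Import structures.
From mathcomp Require Import all_boot all_order all_algebra.
From mathcomp Require Import all_classical all_reals all_analysis.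

Set Implicit Arguments.
Unset Strict Implicit.
Unset Printing Implicit Defensive.

Import Order.TTheory GRing.Theory Num.Theory.
Import numFieldNormedType.Exports.

Local Open Scope classical_set_scope.
Local Open Scope ring_scope.

Section Defs.
Context {R : realType}.

(* f is (a representative of) an element of L2[0,T0] *)
Definition L2fun (T0 : R) (f : R -> R) : Prop :=
  measurable_fun `[0, T0]%classic f /\
  (@lebesgue_measure R).-integrable `[0, T0]%classic (fun t => (f t ^+ 2)%:E).

Definition ip (T0 : R) (f g : R -> R) : R :=
  \int[@lebesgue_measure R]_(t in `[0, T0]%classic) (f t * g t).

Definition L2norm (T0 : R) (f : R -> R) : R := Num.sqrt (ip T0 f f).

(** The linear map D : R^K -> L2 given by its values d k on the canonical basis:
    D delta = \sum_k delta_k d_k *)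
Definition linmap (K : nat) (d : 'I_K -> R -> R) (delta : 'rV[R]_K) : R -> R :=
  fun t => \sum_(k < K) delta ord0 k * d k t.

Definition frechet_L2 (T0 : R) (K : nat) (h : 'rV[R]_K -> R -> R)
    (theta : 'rV[R]_K) (d : 'I_K -> R -> R) : Prop :=
  forall eps : R, 0 < eps -> exists2 r : R, 0 < r &
    forall delta : 'rV[R]_K, `|delta| < r ->
      L2norm T0 (fun t => h (theta + delta) t - h theta t - linmap d delta t)
        <= eps * `|delta|.

Definition evec (K : nat) (k : 'I_K) : 'rV[R]_K := delta_mx ord0 k.

Definition gaussian_law (m v : R) : set R -> \bar R :=
  if v == 0 then @dirac _ R m R else normal_prob m (Num.sqrt v).

Definition is_gaussian {d} {Omega : measurableType d} (P : probability Omega R)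
    (X : Omega -> R) (m v : R) : Prop :=
  measurable_fun setT X /\ 0 <= v /\
  forall A : set R, measurable A -> P (X @^-1` A) = gaussian_law m v A.

Definition jointly_gaussian0 {d} {Omega : measurableType d}
    (P : probability Omega R) (X Y : Omega -> R) : Prop :=
  forall a b : R, exists v : R, is_gaussian P (fun w => a * X w + b * Y w) 0 v.

(** continuous-time white noise of level sig2 on L2[0,T0], given through its
    action f |-> <f, w> on L2[0,T0] (context definition) *)
Definition white_noise {d} {Omega : measurableType d} (P : probability Omega R)
    (T0 sig2 : R) (W : (R -> R) -> Omega -> R) : Prop :=
  forall f g, L2fun T0 f -> L2fun T0 g ->
    jointly_gaussian0 P (W f) (W g) /\
    P.-integrable setT (fun w => (W f w * W g w)%:E) /\
    ('E_P[fun w => (W f w * W g w)%R] = (sig2 * ip T0 f g)%:E)%E.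

Definition mutually_indep {d} {Omega : measurableType d} (P : probability Omega R)
    (N : nat) (v : 'I_N -> Omega -> R) : Prop :=
  forall B : 'I_N -> set R, (forall n, measurable (B n)) ->
    P (\bigcap_(n in [set: 'I_N]) (v n @^-1` B n)) =
    (\prod_(n < N) P (v n @^-1` B n))%E.

(* the family v is independent of the family (W f)_{f in L2[0,T0]}
   (independence of the generating pi-systems) *)
Definition indep_of_noise {d} {Omega : measurableType d} (P : probability Omega R)
    (T0 : R) (N : nat) (v : 'I_N -> Omega -> R) (W : (R -> R) -> Omega -> R) : Prop :=
  forall (B : 'I_N -> set R) (fC : seq ((R -> R) * set R)),
    (forall n, measurable (B n)) ->
    (forall p, p \in fC -> L2fun T0 p.1 /\ measurable p.2) ->
    let E1 := \bigcap_(n in [set: 'I_N]) (v n @^-1` B n) in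
    let E2 := \bigcap_(i in [set i | (i < size fC)%N])
                ((W (nth (fun _ => 0, setT) fC i).1) @^-1`
                   (nth (fun _ => 0, setT) fC i).2) in
    P (E1 `&` E2) = (P E1 * P E2)%E.

(** Lebesgue measure on R^N (= N.-tuple R with its product sigma-algebra):
    characterised by its values on closed boxes *)
Definition lebesgue_tuple (N : nat)
    (nu : {measure set (N.-tuple R) -> \bar R}) : Prop :=
  forall a b : 'I_N -> R, (forall n, a n <= b n) ->
    nu [set x | forall n, a n <= tnth x n <= b n] =
    (\prod_(n < N) (b n - a n)%:E)%E.

(** Fisher information matrix, at theta, of the parametric family of laws of
    the observation c theta' : Omega -> R^N (theta' in Theta):
    J_ij = E_theta[ d_i log p_theta(c) * d_j log p_theta(c) ],
    where p_theta' is a density of the law of c theta' w.r.t. Lebesgue measure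
    on R^N, chosen differentiable in theta' at theta. *)
Definition fisher_info {d} {Omega : measurableType d} (P : probability Omega R)
    (K N : nat) (Theta : set 'rV[R]_K) (c : 'rV[R]_K -> Omega -> N.-tuple R)
    (theta : 'rV[R]_K) (J : 'M[R]_K) : Prop :=
  exists nu : {measure set (N.-tuple R) -> \bar R}, lebesgue_tuple nu /\
  exists p : 'rV[R]_K -> N.-tuple R -> R,
    (forall theta', Theta theta' ->
       measurable_fun setT (p theta') /\ (forall x, 0 <= p theta' x) /\
       forall A, measurable A ->
         (P (c theta' @^-1` A) = \int[nu]_(x in A) (p theta' x)%:E)%E) /\
    (forall x, differentiable (fun theta' => p theta' x) theta) /\
    let score (i : 'I_K) (x : N.-tuple R) :=
      'D_(evec i) (fun theta' => p theta' x) theta / p theta x in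
    forall i j : 'I_K,
      P.-integrable setT
        (fun w => (score i (c theta w) * score j (c theta w))%:E) /\
      ('E_P[fun w => (score i (c theta w) * score j (c theta w))%R] = (J i j)%:E)%E.

End Defs.

(* Main.v *)
(** The covariance [C = sigc2 S^*S + sigd2 I] is positive definite, so [C = M M^T];
    whitening the samples gives [c = M Z + m(theta)] with [m(theta)_n = <h_theta, s_n>]
    and [E exp(a.Z) = exp(|a|^2/2)].  A finite measure on the line is determined by
    its moment generating function; applied to one coordinate at a time, this shows
    that the coordinates of [Z] are independent standard normal.  Lebesgue measure on
    tuples is then obtained as the law of [Z] divided by the normal density, and
    uniqueness of translation-invariant measures gives the density of an affine image
    of [Z], up to a constant factor which the score does not see.  The score is linear
    in [Z], whence the Fisher information.

    The error bound is obtained without differentiating under the integral sign.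
    For finite increments of [theta] along the coordinates, the likelihood ratios
    [L_l] satisfy [E (L_l - 1)(L_l' - 1) = exp(u_l.u_l') - 1], and unbiasedness
    computes [E <xhat - h, D_k> (L_l - 1)].  Expanding
    [0 <= |xhat - h - sum_k,l A_kl (L_l - 1) D_k|^2] is a multidimensional
    Chapman-Robbins inequality; as the increments tend to [0], with [A] the inverse
    information divided by the step, it becomes the trace bound. *)

Require Import Defs.
From HB Require Import structures.
From mathcomp Require Import all_boot all_order all_algebra.
From mathcomp Require Import all_classical all_reals all_analysis.
From mathcomp Require Import measurable_realfun.
From mathcomp Require Import ring lra.

Import Order.TTheory GRing.Theory Num.Theory.
Import numFieldNormedType.Exports.

Local Open Scope classical_set_scope.
Local Open Scope ring_scope.

(** * Measures with density and image measures *)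

(** White noise is given only through pairs: [W f] and [W g] are jointly Gaussian with known
    covariance, while nothing is assumed about larger families or about linearity in [f]. The joint
    law of the samples is still determined, because the covariances alone force [W] to be linear
    almost surely: every linear combination of the samples of [w] is then the single Gaussian
    variable attached to one function of L2. What this yields directly is the moment generating
    function of the noise vector, and this is why every law below is identified through
    exponentials.

    The estimator imposes a second constraint. Only its inner products with fixed functions come
    with measurability and known means; measurability of the squared error norm is left open. The
    error is therefore bounded below pointwise by a finite combination of such inner products, and
    only that lower bound is integrated term by term. *)

Section density_measure.
Context (R : realType) (d : measure_display) (T : measurableType d).
Variables (mu : {measure set T -> \bar R}) (g : T -> R).
Hypotheses (mg : measurable_fun setT g) (g0 : forall x, 0 <= g x).

(* The proofs are arguments so that the measure structure can be inferred. *)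
Definition density_measure & measurable_fun setT g & (forall x, 0 <= g x) :
    set T -> \bar R :=
  fun A => (\int[mu]_(x in A) (g x)%:E)%E.

Local Notation nu := (density_measure mg g0).

Let nu0 : nu set0 = 0%E. Proof. exact: integral_set0. Qed.

Let nu_ge0 A : (0 <= nu A)%E.
Proof. by apply: integral_ge0 => x _; rewrite lee_fin. Qed.

Let nu_sigma_additive : semi_sigma_additive nu.
Proof.
move=> F mF tF mUF; rewrite /density_measure ge0_integral_bigcup//.
- by apply: is_cvg_ereal_nneg_natsum_cond => n _ _; exact: nu_ge0.
- exact/measurable_EFinP/measurable_funTS.
- by move=> x _; rewrite lee_fin.
Qed.

HB.instance Definition _ := isMeasure.Build _ _ _ nu
  nu0 nu_ge0 nu_sigma_additive.

Import HBNNSimple.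

Lemma ge0_integral_density (f : T -> \bar R) : measurable_fun setT f ->
  (forall x, (0 <= f x)%E) ->
  (\int[nu]_x f x = \int[mu]_x (f x * (g x)%:E))%E.
Proof.
move=> mf f0; pose f_ := nnsfun_approx measurableT mf.
have mf_ n : measurable_fun setT (fun x => ((f_ n x)%:E : \bar R)).
  exact/measurable_EFinP/measurable_funP.
have ndf_ x : {homo (fun n => f_ n x) : m n / (m <= n)%N >-> m <= n}.
  by move=> m n mn; exact/lefP/nd_nnsfun_approx.
have cvf_ x : (f_ n x)%:E @[n --> \oo] --> f x.
  by apply: cvg_nnsfun_approx => // *; exact: f0.
have cg x : (g x)%:E \is a fin_num by [].
transitivity (limn (fun n => \int[nu]_x (f_ n x)%:E))%E.
  rewrite -monotone_convergence//.
  - by apply: eq_integral => x _; apply/esym/cvg_lim => //; exact: cvf_.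
  - by move=> n x _; rewrite lee_fin.
  - by move=> x _ m n mn; rewrite lee_fin; exact: ndf_.
transitivity (limn (fun n => \int[mu]_x ((f_ n x)%:E * (g x)%:E)))%E; last first.
  rewrite -monotone_convergence//.
  - apply: eq_integral => x _; apply/cvg_lim => //.
    by apply: cvgeZr => //; exact: cvf_.
  - by move=> n; apply: emeasurable_funM => //; exact/measurable_EFinP.
  - by move=> n x _; rewrite -EFinM lee_fin mulr_ge0.
  - by move=> x _ m n mn; rewrite -!EFinM lee_fin ler_wpM2r//; exact: ndf_.
congr (limn _); apply/funext => n.
transitivity (\sum_(k \in range (f_ n))
    \int[mu]_x (k * \1_(f_ n @^-1` [set k]) x * g x)%:E)%E.
  under eq_integral do rewrite fimfunE -fsumEFin//.
  rewrite ge0_integral_fsum//; last 2 first.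
  - by move=> k; exact/measurable_EFinP/measurable_funM.
  - by move=> k x _; rewrite nnfun_muleindic_ge0.
  apply: eq_fsbigr => k kf; rewrite integralZl_indic_nnsfun// integral_indic//= setIT.
  have k0 : 0 <= k by move: kf; rewrite inE => -[x _ <-].
  rewrite /density_measure integral_mkcond -ge0_integralZl//=; last 2 first.
  - apply/(measurable_restrictT _ _).1 => //.
    exact/measurable_EFinP/measurable_funTS.
  - by move=> x _; rewrite patchE; case: ifP => //; rewrite lee_fin.
  apply: eq_integral => x _; rewrite patchE indicE.
  by case: ifP => _; rewrite -?EFinM /= ?mulr1 ?mulr0 ?mul0r ?mule0.
rewrite -ge0_integral_fsum//.
- apply: eq_integral => x _; rewrite fsumEFin// -EFinM; congr EFin.
  by rewrite [in RHS](fimfunE (f_ n)) mulr_fsuml.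
- by move=> k; apply/measurable_EFinP/measurable_funM => //; exact: measurable_funM.
- move=> k x _; rewrite EFinM mule_ge0 ?lee_fin//.
  have := nnfun_muleindic_ge0 (f_ n) k x.
  by rewrite -EFinM lee_fin.
Qed.

End density_measure.

Section image_measure.
Context (R : realType) (d1 d2 : measure_display).
Context (T1 : measurableType d1) (T2 : measurableType d2).
Variables (mu : {measure set T1 -> \bar R}) (f : T1 -> T2).
Hypothesis mf : measurable_fun setT f.

Definition image_measure & measurable_fun setT f : set T2 -> \bar R :=
  pushforward mu f.

Local Notation nu := (image_measure mf).

Let nu0 : nu set0 = 0%E.
Proof. by rewrite /image_measure /pushforward preimage_set0 measure0. Qed.

Let nu_ge0 A : (0 <= nu A)%E. Proof. exact: measure_ge0. Qed.

Let nu_sigma_additive : semi_sigma_additive nu.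
Proof.
exact: (@measure_semi_sigma_additive _ _ _ (pushforward mu f)).
Qed.

HB.instance Definition _ := isMeasure.Build _ _ _ nu
  nu0 nu_ge0 nu_sigma_additive.

Lemma ge0_integral_image (g : T2 -> \bar R) : measurable_fun setT g ->
  (forall y, (0 <= g y)%E) -> (\int[nu]_y g y = \int[mu]_x g (f x))%E.
Proof. by move=> mg g0; rewrite [LHS]ge0_integral_pushforward. Qed.

End image_measure.

(** * Uniqueness of the moment generating function *)

Section real_bounds.
Context {R : realType}.
Implicit Types x a c : R.

Lemma expR_norm_le x : expR `|x| <= expR x + expR (- x).
Proof.
have [x0|x0] := leP 0 x; first by rewrite ger0_norm// lerDl expR_ge0.
by rewrite ltr0_norm// lerDr expR_ge0.
Qed.

Lemma normX_le_expR x k : `|x| ^+ k <= k`!%:R * expR `|x|.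
Proof.
case: k => [|k]; first by rewrite expr0 mul1r -expR0 ler_expR.
have := expR_ge1Dxn k (normr_ge0 x).
have f0 : 0 < k.+1`!%:R :> R by rewrite ltr0n fact_gt0.
rewrite -(ler_pM2l f0) => /(le_trans _); apply.
by rewrite mulrDr mulrCA divff ?mulr1 ?lerDr ?mulr_ge0// ?ltW// gt_eqF.
Qed.

(** Only [1 + y <= expR y] at [y = x] and [y = - x] enters: it gives
    [0 <= expR x - 1 - x <= x * (expR x - 1)], and the sign of [x] decides how the last product is
    bounded. This quadratic remainder controls all the difference quotients below. *)
Lemma expR_taylor1 x : `|expR x - 1 - x| <= x ^+ 2 * expR `|x|.
Proof.
have h1 := expR_ge1Dx x; have h2 := expR_ge1Dx (- x).
have ep := expR_gt0 x.
have h3 : expR x - 1 <= x * expR x.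
  have : expR x * (1 - x) <= 1.
    by rewrite -[leRHS](expRxMexpNx_1 x) ler_wpM2l// ltW.
  by lra.
rewrite [leLHS]ger0_norm; last by lra.
have [x0|x0] := leP 0 x.
  rewrite ger0_norm//; have : x * (expR x - 1) <= x * (x * expR x) by rewrite ler_wpM2l.
  by rewrite expr2; lra.
rewrite ltr0_norm//; have e1 : 1 <= expR (- x) by rewrite -expR0 ler_expR; lra.
have h4 : x * (expR x - 1) <= x ^+ 2 by rewrite expr2; nra.
have : x ^+ 2 <= x ^+ 2 * expR (- x) by rewrite ler_peMr ?sqr_ge0.
by lra.
Qed.

Lemma bernoulli_ineq x n : -1 <= x -> 1 + n%:R * x <= (1 + x) ^+ n.
Proof.
move=> x1; elim: n => [|n ih]; first by rewrite mul0r addr0 expr0.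
have n0 : 0 <= n%:R :> R by [].
have := ler_wpM2l (_ : 0 <= 1 + x) ih; rewrite exprS.
rewrite -natr1 => h; apply: le_trans (h _); last by lra.
have : 0 <= n%:R * (x * x) by rewrite mulr_ge0// -expr2 sqr_ge0.
by lra.
Qed.

(** Split [x ^+ n] into two factors [r ^+ n] with [r] the square root of [x]: Bernoulli's inequality
    for [r^-1] bounds [n%:R * r ^+ n], and the other factor tends to 0. *)
Lemma cvg_nat_geometric x : 0 <= x < 1 -> n%:R * x ^+ n @[n --> \oo] --> (0 : R).
Proof.
move=> /andP[x0 x1].
have [->|xn0] := eqVneq x 0.
  apply/cvgrPdist_le => e e0; near=> n.
  by rewrite expr0n gtn_eqF ?mulr0 ?subrr ?normr0 ?(ltW e0)//; near: n; exists 1%N.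
pose r := Num.sqrt x.
have r0 : 0 < r by rewrite sqrtr_gt0 lt_neqAle eq_sym xn0.
have r1 : r < 1 by rewrite -sqrtr1 ltr_sqrt.
pose C := (r^-1 - 1)^-1.
have rV : 1 < r^-1 by rewrite invf_gt1.
have nr n : n%:R * r ^+ n <= C.
  have := @bernoulli_ineq (r^-1 - 1) n; rewrite (_ : 1 + (r^-1 - 1) = r^-1); last by lra.
  rewrite exprVn => /(_ (ltac:(lra))) h.
  rewrite -ler_pdivlMr ?exprn_gt0// /C.
  rewrite -ler_pdivrMl ?invr_gt0 ?subr_gt0// invrK mulrC.
  by lra.
apply: (@squeeze_cvgr _ _ _ _ (fun=> 0) (fun n => C * r ^+ n)).
- apply: nearW => n; rewrite mulr_ge0 ?exprn_ge0//=.
  rewrite -[x in x ^+ n](sqr_sqrtr x0) -/r expr2 exprMn mulrA.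
  by rewrite ler_wpM2r// exprn_ge0// ltW.
- exact: cvg_cst.
- rewrite -[X in _ --> X](mulr0 C); apply: cvgMr.
  by apply: cvg_expr; rewrite ger0_norm ?ltW.
Unshelve. all: by end_near. Qed.

(* Brosowski-Deutsch polynomials, in the variable y, for the threshold y > 0. *)
Definition step_poly n : {poly R} :=
  (1 - ((1 - 'X) * (2^-1)%:P) ^+ n) ^+ (n * 2 ^ n).

Lemma step_polyE n y :
  (step_poly n).[y] = (1 - ((1 - y) / 2) ^+ n) ^+ (n * 2 ^ n).
Proof. by rewrite /step_poly !(hornerE, horner_exp). Qed.

Lemma step_poly_bound n y : -1 <= y <= 1 -> 0 <= (step_poly n).[y] <= 1.
Proof.
move=> /andP[y1 y2]; rewrite step_polyE.
have s01 : 0 <= ((1 - y) / 2) ^+ n <= 1.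
  rewrite exprn_ge0 ?exprn_ile1//; lra.
rewrite exprn_ge0 ?exprn_ile1//; lra.
Qed.

(** With [s = (1 - y) / 2], one has [0 < y] exactly when [2 * s < 1]. The outer exponent is chosen
    so that Bernoulli's inequality produces [n (2 s)^n] on both sides of the threshold: for [0 < y]
    the value is at least [1 - n (2 s)^n]; otherwise, since [1 - s^n] times [1 + s^n] is at most 1,
    it is at most [1 / (n + 1)]. *)
Lemma cvg_step_poly y : -1 <= y <= 1 ->
  (step_poly n).[y] @[n --> \oo] --> (\1_(`]0, +oo[%classic : set R) y : R).
Proof.
move=> /[dup] y1 /andP[ya yb]; rewrite indicE; set s := (1 - y) / 2.
have s0 : 0 <= s by rewrite /s; lra.
have s1 : s <= 1 by rewrite /s; lra.
have sn0 n : 0 <= s ^+ n by rewrite exprn_ge0.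
have sn1 n : s ^+ n <= 1 by rewrite exprn_ile1.
have [yp|yn] := ltP 0 y.
  rewrite mem_set; last by rewrite /= in_itv /= yp.
  have h : 1 - n%:R * (2 * s) ^+ n @[n --> \oo] --> (1 - 0 : R).
    apply: cvgB; first exact: cvg_cst.
    by apply: cvg_nat_geometric; rewrite /s; lra.
  rewrite subr0 in h.
  apply: (@squeeze_cvgr _ _ _ _ _ (fun=> 1) _ _ 1 h); last exact: cvg_cst.
  apply: nearW => n; rewrite (andP (step_poly_bound n y y1)).2 andbT step_polyE.
  have := @bernoulli_ineq (- s ^+ n) (n * 2 ^ n); rewrite mulrN.
  rewrite natrM natrX -mulrA -exprMn; apply.
  by have := sn1 n; lra.
rewrite memNset; last by rewrite /= in_itv /= andbT; apply/negP; rewrite -leNgt.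
apply: (@squeeze_cvgr _ _ _ _ (fun=> 0) (fun n => harmonic n : R)).
- apply: nearW => n; rewrite (andP (step_poly_bound n y y1)).1 /= step_polyE.
  have x0 := sn0 n; have x1 := sn1 n.
  rewrite -/s /harmonic /= -[leRHS]div1r ler_pdivlMr ?ltr0n//.
  have h : n.+1%:R <= (1 + s ^+ n) ^+ (n * 2 ^ n).
    apply: le_trans (bernoulli_ineq (s ^+ n) (n * 2 ^ n) _); last by lra.
    rewrite natrM natrX -mulrA -exprMn -natr1 addrC lerD2l.
    rewrite ler_peMr// exprn_ege1// /s; lra.
  apply: (@le_trans _ _ ((1 - s ^+ n) ^+ (n * 2 ^ n) * (1 + s ^+ n) ^+ (n * 2 ^ n))).
    by rewrite ler_wpM2l// exprn_ge0//; lra.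
  rewrite -exprMn exprn_ile1//; nra.
- exact: cvg_cst.
- exact: cvg_harmonic.
Qed.

(** Termwise comparison with the exponential series; the bound does not depend on [n] and so serves
    as a majorant in dominated convergence. *)
Lemma series_sin_coeff_bound x n : `|series (sin_coeff x) n| <= expR `|x|.
Proof.
apply: (@le_trans _ _ (series (exp_coeff `|x|) n)).
  rewrite /series /=; apply: le_trans (ler_norm_sum _ _ _) _.
  apply: ler_sum => i _; rewrite /sin_coeff /exp_coeff /= !normrM.
  rewrite normrX normrN normr1 expr1n mulr1 -normrX normfV [X in _ / X]ger0_norm//.
  rewrite ler_wpM2r ?invr_ge0// -[leRHS]mul1r normrX ler_wpM2r// ?exprn_ge0//.
  by case: (odd i) => /=; rewrite ?normr0 ?normr1.
apply: nondecreasing_cvgn_le; last exact: is_cvg_series_exp_coeff.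
apply/nondecreasing_seqP => k; rewrite /series /= big_nat_recr//= lerDl.
by rewrite /exp_coeff /= divr_ge0// exprn_ge0.
Qed.

End real_bounds.

(* Differentiating the moment generating function in [a] gives the integrals of
   [x^k exp(a x)], hence, by the power series of the sine, those of polynomials in
   [sin (b (x - y))].  A polynomial approximation of the step function followed by
   [b -> 0] gives the mass of the ray [x > y]. *)
Section mgf_uniqueness.
Context {R : realType}.
Variables Q1 Q2 : {measure set R -> \bar R}.

(** The integrability clauses make this class stable under linear combinations and dominated
    pointwise limits, the only operations needed to pass from exponentials to indicators of rays. *)
Definition same_integral (f : R -> R) : Prop :=
  [/\ Q1.-integrable setT (fun x => (f x)%:E),
      Q2.-integrable setT (fun x => (f x)%:E) &
      (\int[Q1]_x (f x)%:E = \int[Q2]_x (f x)%:E)%E].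

Lemma same_integralZ a f : same_integral f -> same_integral (fun x => a * f x).
Proof.
move=> [i1 i2 e]; split.
- by under eq_fun do rewrite EFinM; exact: integrableZl.
- by under eq_fun do rewrite EFinM; exact: integrableZl.
- under eq_integral do rewrite EFinM.
  under [RHS]eq_integral do rewrite EFinM.
  by rewrite !integralZl// e.
Qed.

Lemma same_integral_sum (I : Type) (s : seq I) (P : pred I) (f : I -> R -> R) :
  (forall i, same_integral (f i)) ->
  same_integral (fun x => \sum_(i <- s | P i) f i x).
Proof.
move=> h; split.
- under eq_fun do rewrite -sumEFin.
  by apply: integrable_sum => // i _; case: (h i).
- under eq_fun do rewrite -sumEFin.
  by apply: integrable_sum => // i _; case: (h i).
- under eq_integral do rewrite -sumEFin.
  under [RHS]eq_integral do rewrite -sumEFin.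
  rewrite !integral_sum//; last 2 first.
  + by move=> i; case: (h i).
  + by move=> i; case: (h i).
  by apply: eq_bigr => i _; case: (h i).
Qed.

Lemma same_integralD f g : same_integral f -> same_integral g ->
  same_integral (fun x => f x + g x).
Proof.
move=> hf hg.
have := @same_integral_sum _ [:: true; false] xpredT (fun b => if b then f else g).
under eq_fun do rewrite big_cons big_cons big_nil addr0.
by apply; case.
Qed.

Lemma same_integral_measurable f : same_integral f -> measurable_fun setT f.
Proof. by move=> [/measurable_int/measurable_EFinP]. Qed.

Lemma same_integral_lim (f_ : nat -> R -> R) (f g : R -> R) :
  (forall n, same_integral (f_ n)) -> same_integral g ->
  (forall n x, `|f_ n x| <= g x) ->
  (forall x, f_ n x @[n --> \oo] --> f x) ->
  same_integral f.
Proof.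
move=> hf [g1 g2 _] fg ff.
have mf_ n := same_integral_measurable _ (hf n).
have mf : measurable_fun setT f.
  by apply: (@measurable_fun_cvg _ _ _ setT f_) => // x _; exact: ff.
have mE n : measurable_fun setT (fun x => (f_ n x)%:E).
  exact/measurable_EFinP.
have mfE : measurable_fun setT (fun x => (f x)%:E) by exact/measurable_EFinP.
have cvE x : (f_ n x)%:E @[n --> \oo] --> (f x)%:E by apply: cvg_EFin; [exact: nearW|exact: ff].
have [i1 _ c1] := @dominated_convergence _ _ _ Q1 setT measurableT
  (fun n x => (f_ n x)%:E) (fun x => (f x)%:E) (fun x => (g x)%:E) mE mfE
  (aeW _ (fun x _ => cvE x)) g1 (aeW _ (fun x n _ => fg n x)).
have [i2 _ c2] := @dominated_convergence _ _ _ Q2 setT measurableT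
  (fun n x => (f_ n x)%:E) (fun x => (f x)%:E) (fun x => (g x)%:E) mE mfE
  (aeW _ (fun x _ => cvE x)) g2 (aeW _ (fun x n _ => fg n x)).
split => //.
have e : [sequence (\int[Q1]_x (f_ n x)%:E)%E]_n =
    [sequence (\int[Q2]_x (f_ n x)%:E)%E]_n.
  by apply/funext => n /=; case: (hf n).
rewrite -(cvg_lim _ c1)// e; exact: cvg_lim.
Qed.

Hypothesis same_mgf : forall a, same_integral (fun x => expR (a * x)).
Variable y : R.

Lemma same_shifted_mgf a : same_integral (fun x => expR (a * (x - y))).
Proof.
have := same_integralZ (expR (- (a * y))) _ (same_mgf a).
by under eq_fun do rewrite -expRD addrC -mulrBr.
Qed.

Lemma same_cosh c :
  same_integral (fun x => expR (c * (x - y)) + expR (- c * (x - y))).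
Proof. by apply: same_integralD; exact: same_shifted_mgf. Qed.

(** Provides majorants that lie in the class themselves: the sum of two exponentials on the right is
    covered by [same_cosh]. *)
Lemma poly_exp_bound k c (x : R) : 0 <= c ->
  `|x - y| ^+ k * expR (c * `|x - y|) <=
  k`!%:R * (expR ((1 + c) * (x - y)) + expR (- (1 + c) * (x - y))).
Proof.
move=> c0; apply: (@le_trans _ _ (k`!%:R * (expR `|x - y| * expR (c * `|x - y|)))).
  by rewrite mulrA ler_wpM2r ?expR_ge0// normX_le_expR.
rewrite ler_wpM2l// -expRD mulNr.
apply: le_trans (expR_norm_le _); rewrite ler_expR normrM ger0_norm; first by lra.
by lra.
Qed.

Lemma same_poly_exp k a :
  same_integral (fun x => (x - y) ^+ k * expR (a * (x - y))).
Proof.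
elim: k a => [|k ih] a.
  by under eq_fun do rewrite expr0 mul1r; exact: same_shifted_mgf.
(* The difference quotient in [a] with step [n.+1%:R^-1]; the induction hypothesis, available for
   all [a], covers both of its exponentials. *)
pose f_ n x := (x - y) ^+ k * expR (a * (x - y)) *
  (n.+1%:R * (expR (n.+1%:R^-1 * (x - y)) - 1)).
have taylor n x :
    `|n.+1%:R * (expR (n.+1%:R^-1 * (x - y)) - 1) - (x - y)| <=
    n.+1%:R^-1 * ((x - y) ^+ 2 * expR `|x - y|).
  have n0 : 0 < n.+1%:R :> R by [].
  have := expR_taylor1 (n.+1%:R^-1 * (x - y)).
  set u := n.+1%:R^-1 * (x - y) => h.
  have -> : x - y = n.+1%:R * u by rewrite /u mulrA divff ?mul1r// gt_eqF.
  clearbody u; rewrite -mulrBr normrM (ger0_norm (ltW n0)).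
  apply: le_trans (ler_wpM2l (ltW n0) h) _.
  have -> : n.+1%:R^-1 * ((n.+1%:R * u) ^+ 2 * expR `|n.+1%:R * u|) =
      n.+1%:R * (u ^+ 2 * expR `|n.+1%:R * u|) by field; rewrite gt_eqF.
  rewrite ler_wpM2l// ler_wpM2l ?sqr_ge0//.
  by rewrite ler_expR normrM (ger0_norm (ltW n0)) ler_peMl// ler1n.
(* With [w = x - y], the quotient is at most [|w| + |w|^2] times [exp |w|]; the two summands give
   the two factorials through [poly_exp_bound] at [k.+1] and [k.+2], with rate [|a| + 1]. *)
apply: (@same_integral_lim f_ _ (fun x => (k.+1`!%:R + k.+2`!%:R) *
   (expR ((1 + (`|a| + 1)) * (x - y)) + expR (- (1 + (`|a| + 1)) * (x - y))))).
- move=> n; have := same_integralD _ _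
    (same_integralZ n.+1%:R _ (ih (a + n.+1%:R^-1)))
    (same_integralZ (- n.+1%:R) _ (ih a)).
  congr same_integral; apply/funext => x; rewrite /f_ mulrDl expRD; ring.
- exact: same_integralZ (same_cosh _).
- move=> n x; rewrite /f_.
  set w := x - y; set v := _ * (_ - 1).
  have hv : `|v| <= `|w| + w ^+ 2 * expR `|w|.
    have := taylor n x; rewrite -/w -/v => h.
    have : `|v| <= `|w| + `|v - w|.
      by rewrite -{1}(subrK w v) addrC; exact: ler_normD.
    move/le_trans; apply; rewrite lerD2l; apply: le_trans h _.
    rewrite ler_piMl 1?mulr_ge0 ?sqr_ge0 ?expR_ge0//.
    by rewrite invf_le1// ler1n.
  have e1 : 1 <= expR `|w| by rewrite -expR0 ler_expR.
  have hv2 : `|v| <= (`|w| + `|w| ^+ 2) * expR `|w|.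
    apply: le_trans hv _; rewrite mulrDl -[`|w| ^+ 2]normrX (ger0_norm (sqr_ge0 w)).
    by rewrite lerD2r ler_peMr.
  rewrite normrM normrM normrX (ger0_norm (expR_ge0 _)).
  apply: (@le_trans _ _ (`|w| ^+ k * expR (`|a| * `|w|) *
      ((`|w| + `|w| ^+ 2) * expR `|w|))).
    rewrite ler_pM ?mulr_ge0 ?exprn_ge0 ?expR_ge0//.
    by rewrite ler_wpM2l ?exprn_ge0// ler_expR -normrM ler_norm.
  have ca : 0 <= `|a| + 1 by rewrite addr_ge0.
  have h1 := poly_exp_bound k.+1 _ x ca; have h2 := poly_exp_bound k.+2 _ x ca.
  rewrite [leRHS]mulrDl; apply: le_trans (lerD h1 h2); rewrite -/w.
  rewrite [(`|a| + 1) * _]mulrDl mul1r expRD !exprS expr0.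
  by rewrite le_eqVlt; apply/orP; left; apply/eqP; ring.
- move=> x; rewrite /f_ exprSr -mulrA [(x - y) * _]mulrC mulrA.
  apply: cvgMr.
  apply/cvgrPdist_le => e e0.
  set B := (x - y) ^+ 2 * expR `|x - y|.
  have : harmonic n * B @[n --> \oo] --> (0 * B : R).
    by apply: cvgMl; exact: cvg_harmonic.
  rewrite mul0r => /cvgr0Pnorm_le/(_ _ e0); apply: filterS => n.
  move=> h; rewrite distrC; apply: le_trans (taylor n x) _.
  by apply: le_trans (ler_norm _) h.
Qed.

Lemma same_monomial k : same_integral (fun x => (x - y) ^+ k).
Proof.
have := same_poly_exp k 0.
by under eq_fun do rewrite mul0r expR0 mulr1.
Qed.

(** One sine factor at a time is replaced by the partial sums of its power series. This raises the
    power of [x - y], so the induction on [m] must hold for every [k]. *)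
Lemma same_monomial_sin b m k :
  same_integral (fun x => (x - y) ^+ k * sin (b * (x - y)) ^+ m).
Proof.
elim: m k => [|m ih] k.
  by under eq_fun do rewrite expr0 mulr1; exact: same_monomial.
pose S n x := series (sin_coeff (b * (x - y))) n.
apply: (@same_integral_lim (fun n x => (x - y) ^+ k * sin (b * (x - y)) ^+ m * S n x)
  _ (fun x => k`!%:R *
   (expR ((1 + `|b|) * (x - y)) + expR (- (1 + `|b|) * (x - y))))).
- move=> n.
  have := @same_integral_sum _ (index_iota 0 n) xpredT
    (fun i x => ((odd i)%:R * (-1) ^+ i.-1./2 * b ^+ i / i`!%:R) *
      ((x - y) ^+ (k + i) * sin (b * (x - y)) ^+ m)).
  rewrite (_ : (fun x => \sum_(0 <= i < n) _) =
      fun x => (x - y) ^+ k * sin (b * (x - y)) ^+ m * S n x); last first.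
    apply/funext => x; rewrite /S /series /= big_distrr /=; apply: eq_bigr => i _.
    by rewrite /sin_coeff /= exprMn exprD; ring.
  by apply => i; apply: same_integralZ.
- exact: same_integralZ (same_cosh _).
- move=> n x; rewrite !normrM !normrX.
  apply: le_trans (poly_exp_bound k _ x (normr_ge0 b)).
  rewrite -mulrA ler_wpM2l ?exprn_ge0// -normrM.
  apply: le_trans (series_sin_coeff_bound _ n).
  by rewrite ler_piMl// exprn_ile1// sin_max.
- move=> x; rewrite exprSr mulrA; apply: cvgMr.
  rewrite unlock; exact: is_cvg_series_sin_coeff.
Qed.

Lemma same_poly_sin b (p : {poly R}) :
  same_integral (fun x => p.[sin (b * (x - y))]).
Proof.
under eq_fun do rewrite horner_coef.
apply: same_integral_sum => i; apply: same_integralZ.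
have := same_monomial_sin b i 0.
by under eq_fun do rewrite expr0 mul1r.
Qed.

Lemma same_sin_gt0 b :
  same_integral (fun x => \1_(`]0, +oo[%classic : set R) (sin (b * (x - y)))).
Proof.
have b1 x : -1 <= sin (b * (x - y)) <= 1 by rewrite sin_geN1 sin_le1.
apply: (@same_integral_lim (fun n x => (step_poly n).[sin (b * (x - y))]) _ (fun=> 1)).
- by move=> n; exact: same_poly_sin.
- have := same_mgf 0.
  by under eq_fun do rewrite mul0r expR0.
- move=> n x; have /andP[h0 h1] := step_poly_bound n _ (b1 x).
  by rewrite ger0_norm.
- by move=> x; exact: cvg_step_poly.
Qed.

Lemma same_ray : same_integral (fun x => \1_(`]y, +oo[%classic : set R) x).
Proof.
apply: (@same_integral_lim (fun n x =>
  \1_(`]0, +oo[%classic : set R) (sin (n.+1%:R^-1 * (x - y)))) _ (fun=> 1)).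
- by move=> n; exact: same_sin_gt0.
- have := same_mgf 0.
  by under eq_fun do rewrite mul0r expR0.
- by move=> n x; rewrite indicE; case: (_ \in _); rewrite ?normr1 ?normr0.
- move=> x.
  (* Once the argument of the sine is below 1 in absolute value, hence below pi, the sine has the
     sign of [x - y], and the sequence of indicators is eventually constant. *)
  have h : \forall n \near \oo, `|x - y| * n.+1%:R^-1 < 1 :> R.
    have : `|x - y| * harmonic n @[n --> \oo] --> (`|x - y| * 0 : R).
      by apply: cvgMr; exact: cvg_harmonic.
    rewrite mulr0 => /cvgr0Pnorm_lt/(_ 1 ltr01); apply: filterS => n.
    by apply: le_lt_trans; exact: ler_norm.
  apply: cvg_near_cst; apply: filterS h => n h; rewrite !indicE; congr (_ %:R); congr nat_of_bool.
  apply/idP/idP; rewrite !inE /= !in_itv /= !andbT; last first.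
    rewrite -subr_gt0 => xy; apply: sin_gt0_pi.
    rewrite mulr_gt0 ?invr_gt0//= mulrC.
    move: h; rewrite gtr0_norm// => h.
    by rewrite (lt_trans h)// (lt_le_trans _ (pi_ge2 R))// ltr1n.
  apply: contraTT; rewrite -!leNgt -subr_le0 => xy.
  rewrite -oppr_ge0 -sinN; apply: sin_ge0_pi.
  rewrite -mulrN mulr_ge0 ?oppr_ge0 ?invr_ge0//= mulrC.
  apply: (@le_trans _ _ (`|x - y| * n.+1%:R^-1)).
    by rewrite ler_wpM2r ?invr_ge0// -normrN ler_norm.
  by rewrite (le_trans (ltW h))// (le_trans _ (pi_ge2 R))// ler1n.
Qed.

End mgf_uniqueness.

(** Open rays form a generating pi-system; the case [a = 0] of the hypothesis supplies the
    finiteness that uniqueness of measures requires. *)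
Lemma mgf_unique {R : realType} (Q1 Q2 : {measure set R -> \bar R}) :
  (forall a, same_integral Q1 Q2 (fun x => expR (a * x))) ->
  forall A, measurable A -> Q1 A = Q2 A.
Proof.
move=> h A mA.
have ray y : Q1 `]y, +oo[%classic = Q2 `]y, +oo[%classic.
  have [_ _] := same_ray Q1 Q2 h y.
  by rewrite !integral_indic// !setIT.
have fin : (Q1 setT < +oo)%E.
  have [/integrableP[_ +] _ _] := h 0.
  under eq_integral do rewrite mul0r expR0 abse1.
  by rewrite integral_cst// mul1e.
apply: (@measure_unique _ R R [set B | exists x, B = `]x, +oo[%classic]
  (fun n => `]- n%:R, +oo[%classic)) => //.
- exact: RGenOInfty.measurableE.
- move=> _ _ [x ->] [z ->]; exists (Num.max x z).
  rewrite predeqE => t /=; rewrite !in_itv/= !andbT gt_max.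
  by split => [[-> ->]|/andP[]].
- by move=> n; exists (- n%:R).
- rewrite -subTset => x _; exists (Num.bound `|x|) => //=.
  rewrite in_itv/= andbT ltrNl.
  by rewrite (le_lt_trans (ler_norm _))// normrN; exact: archi_boundP.
- by move=> _ [x ->]; exact: ray.
- move=> n; apply: le_lt_trans fin; apply: le_measure; rewrite ?inE//.
Qed.

(** * Gaussian variables *)

Section weighted_law.
Context {R : realType} (d : measure_display) (T : measurableType d).
Variables (P : {measure set T -> \bar R}) (Y : T -> R).
Hypothesis mY : measurable_fun setT Y.

Lemma weighted_lawE (H : T -> R) (mH : measurable_fun setT H)
    (H0 : forall w, 0 <= H w) (A : set R) :
  (\int[P]_w (H w * \1_A (Y w))%:E =
   image_measure _ _ _ _ _ (density_measure _ _ _ P H mH H0) _ mY A)%E.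
Proof.
transitivity (\int[P]_(w in Y @^-1` A) (H w)%:E)%E => //.
rewrite [RHS]integral_mkcond; apply: eq_integral => w _; rewrite patchE indicE.
have -> : (w \in Y @^-1` A) = (Y w \in A) by apply/idP/idP; rewrite !inE.
by case: ifP; rewrite ?mulr1 ?mulr0.
Qed.

(** The weight [H] is meant to hold all factors but one of a product of functions of several
    variables, so that the statement concerns the law of a single variable under a changed
    measure. *)
Lemma weighted_law_eq (H : T -> R) (k : R) (mu : {measure set R -> \bar R}) :
  measurable_fun setT H -> (forall w, 0 <= H w) -> 0 <= k ->
  (forall A : set R, measurable A ->
     (\int[P]_w (H w * \1_A (Y w))%:E = k%:E * mu A)%E) ->
  forall f : R -> R, measurable_fun setT f -> (forall x, 0 <= f x) ->
  (\int[P]_w (H w * f (Y w))%:E = k%:E * \int[mu]_x (f x)%:E)%E.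
Proof.
move=> mH H0 k0 h f mf f0.
pose Q := image_measure _ _ _ _ _ (density_measure _ _ _ P H mH H0) _ mY.
have mfE : measurable_fun setT (fun x => (f x)%:E) by exact/measurable_EFinP.
have QE A : measurable A -> Q A = (k%:E * mu A)%E.
  by move=> mA; rewrite -h// weighted_lawE.
transitivity (\int[Q]_x (f x)%:E)%E.
  rewrite [RHS]ge0_integral_image//=.
  rewrite ge0_integral_density//.
  - by apply: eq_integral => w _ /=; rewrite -EFinM mulrC.
  - exact/measurable_EFinP/measurableT_comp.
  - by move=> w /=; rewrite lee_fin.
transitivity (\int[mscale (NngNum k0) mu]_x (f x)%:E)%E.
  by apply: eq_measure_integral => A mA _; exact: QE.
by rewrite ge0_integral_mscale//= => x _; rewrite lee_fin.
Qed.

End weighted_law.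

Section normal_mgf.
Context {R : realType}.

(* [normal_prob] lives on [measurableTypeR R], whose display differs from that of [R]. *)
Definition normal_law (s : R) : {measure set R -> \bar R} :=
  image_measure R _ _ (measurableTypeR R) R (normal_prob 0 s) id
    (@measurable_id _ _ _).

Lemma integral_normal_law (s : R) (f : R -> R) : measurable_fun setT f ->
  (forall x, 0 <= f x) ->
  (\int[normal_law s]_x (f x)%:E =
   \int[lebesgue_measure]_x (f x * normal_pdf 0 s x)%:E)%E.
Proof.
move=> mf f0; rewrite [LHS]ge0_integral_image//=; last exact/measurable_EFinP.
have := @ge0_integral_density R _ (measurableTypeR R) lebesgue_measure
  (normal_pdf 0 s) (measurable_normal_pdf 0 s) (normal_pdf_ge0 0 s)
  (fun x => (f x)%:E).
apply.
- exact/measurable_EFinP.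
- by move=> x; rewrite lee_fin.
Qed.

(** Completing the square turns the integrand into a multiple of the normal density centred at
    [s ^+ 2 * a]. *)
Lemma normal_mgf (s a : R) : s != 0 ->
  (\int[normal_law s]_x (expR (a * x))%:E = (expR (s ^+ 2 * a ^+ 2 / 2))%:E)%E.
Proof.
move=> s0; rewrite integral_normal_law; last 2 first.
- by apply: measurableT_comp => //; exact: measurable_funM.
- by move=> x; exact: expR_ge0.
transitivity (\int[lebesgue_measure]_x
   ((expR (s ^+ 2 * a ^+ 2 / 2))%:E * (normal_pdf (s ^+ 2 * a) s x)%:E))%E.
  apply: eq_integral => x _; rewrite -EFinM !normal_pdfE// /normal_fun.
  rewrite mulrCA [in RHS]mulrCA -!expRD; congr (_ * expR _)%:E.
  by field.
rewrite integralZl//; last exact: integrable_normal_pdf.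
by rewrite integral_normal_pdf mule1.
Qed.

End normal_mgf.

Section gaussian_weight.
Context {R : realType} (d : measure_display) (T : measurableType d).
Variables (P : {measure set T -> \bar R}) (Y : T -> R).
Hypothesis mY : measurable_fun setT Y.

Lemma measurable_expRM a : measurable_fun setT (fun w => expR (a * Y w)).
Proof. by apply: measurableT_comp => //; exact: measurable_funM. Qed.

(** Uniqueness of the moment generating function holds for finite measures, not only for
    probabilities. It therefore applies to the law of [Y] weighted by [H], whose total mass is
    [k]. *)
Lemma weighted_gaussian (H : T -> R) (k : R) :
  measurable_fun setT H -> (forall w, 0 <= H w) -> 0 <= k ->
  (forall a, (\int[P]_w (H w * expR (a * Y w))%:E = (k * expR (a ^+ 2 / 2))%:E)%E) ->
  forall f : R -> R, measurable_fun setT f -> (forall x, 0 <= f x) ->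
  (\int[P]_w (H w * f (Y w))%:E = k%:E * \int[normal_law 1]_x (f x)%:E)%E.
Proof.
move=> mH H0 k0 h f mf f0; apply: weighted_law_eq => // A mA.
pose Q1 := image_measure _ _ _ _ _ (density_measure _ _ _ P H mH H0) _ mY.
pose Q2 := mscale (NngNum k0) (normal_law 1).
have mE a : measurable_fun setT (fun x : R => (expR (a * x))%:E).
  by apply/measurable_EFinP/measurableT_comp => //; exact: measurable_funM.
have E0 a (x : R) : (0 <= (expR (a * x))%:E :> \bar R)%E by rewrite lee_fin expR_ge0.
have Q1E a : (\int[Q1]_x (expR (a * x))%:E = (k * expR (a ^+ 2 / 2))%:E)%E.
  rewrite /Q1 ge0_integral_image//= ge0_integral_density//.
  - by rewrite -h; apply: eq_integral => w _ /=; rewrite -EFinM mulrC.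
  - exact/measurable_EFinP/measurable_expRM.
have Q2E a : (\int[Q2]_x (expR (a * x))%:E = (k * expR (a ^+ 2 / 2))%:E)%E.
  by rewrite /Q2 ge0_integral_mscale//= normal_mgf ?oner_neq0// expr1n mul1r EFinM.
rewrite (weighted_lawE _ _ _ _ mY _ mH H0) -/Q1.
apply: (mgf_unique Q1 Q2) => // a; split.
- apply/integrableP; split => //.
  under eq_integral do rewrite gee0_abs//.
  by rewrite Q1E ltry.
- apply/integrableP; split => //.
  under eq_integral do rewrite gee0_abs//.
  by rewrite Q2E ltry.
- by rewrite Q1E Q2E.
Qed.

End gaussian_weight.

(** * Transfer of product formulas between classes of test functions *)

Section replacement.
Context {R : realType} (d : measure_display) (T : measurableType d).
Variables (P : {measure set T -> \bar R}) (n : nat) (Y : 'I_n -> T -> R).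
Hypothesis mY : forall i, measurable_fun setT (Y i).
Variables (Phi Psi : 'I_n -> set (R -> R)) (I : 'I_n -> (R -> R) -> R).
Hypothesis mPhi : forall i f, Phi i f -> measurable_fun setT f.
Hypothesis Phi_ge0 : forall i f, Phi i f -> forall x, 0 <= f x.
Hypothesis mPsi : forall i f, Psi i f -> measurable_fun setT f.
Hypothesis Psi_ge0 : forall i f, Psi i f -> forall x, 0 <= f x.
Hypothesis I_ge0 : forall i f, Phi i f \/ Psi i f -> 0 <= I i f.
Hypothesis replace1 : forall i (H : T -> R) k, measurable_fun setT H ->
  (forall w, 0 <= H w) -> 0 <= k ->
  (forall f, Phi i f -> (\int[P]_w (H w * f (Y i w))%:E = (k * I i f)%:E)%E) ->
  (forall f, Psi i f -> (\int[P]_w (H w * f (Y i w))%:E = (k * I i f)%:E)%E).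

(* [I i] is the expectation under the intended law of [Y i]: a product formula known for
   the test functions [Phi] (exponentials) passes to the class [Psi] (all nonnegative
   measurable functions) by changing one factor at a time, the others being absorbed in
   the weight [H]. *)
Lemma replace_all :
  (forall F, (forall i, Phi i (F i)) ->
     (\int[P]_w (\prod_i F i (Y i w))%:E = (\prod_i I i (F i))%:E)%E) ->
  forall F, (forall i, Psi i (F i)) ->
     (\int[P]_w (\prod_i F i (Y i w))%:E = (\prod_i I i (F i))%:E)%E.
Proof.
move=> h.
(* Coordinates below [k] carry functions of [Psi], the others functions of [Phi]. The family [F] is
   quantified inside, since replacing coordinate [k] calls on the hypothesis for every function of
   [Phi] at that place. *)
suff main k : (k <= n)%N -> forall F, (forall i : 'I_n, (i < k)%N -> Psi i (F i)) ->
    (forall i : 'I_n, (k <= i)%N -> Phi i (F i)) ->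
    (\int[P]_w (\prod_i F i (Y i w))%:E = (\prod_i I i (F i))%:E)%E.
  by move=> F hF; apply: (main n) => // i; rewrite leqNgt ltn_ord.
elim: k => [_ F _ hF|k ih kn F F1 F2]; first by apply: h => i; exact: hF.
pose j := Ordinal kn.
have Pj i : i != j -> (i < k)%N \/ (k < i)%N.
  by move=> ij; apply/orP; rewrite -neq_ltn; apply: contra ij => /eqP ij; apply/eqP/val_inj.
have FPP i : Phi i (F i) \/ Psi i (F i).
  by have [ik|ik] := leqP k.+1 i; [left; exact: F2|right; exact: F1].
pose H w := \prod_(i | i != j) F i (Y i w).
have dec G w : (forall i, i != j -> G i = F i) ->
    \prod_i G i (Y i w) = H w * G j (Y j w).
  move=> GF; rewrite (bigD1 j)//= mulrC; congr (_ * _).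
  by apply: eq_bigr => i ij; rewrite GF.
under eq_integral do rewrite (dec F)//.
rewrite (bigD1 j)//= mulrC; apply: replace1.
- rewrite /H; under eq_fun do rewrite -big_filter.
  apply: measurable_prod => i _; apply: measurableT_comp (mY i).
  by case: (FPP i) => [/mPhi|/mPsi].
- by move=> w; apply: prodr_ge0 => i _; case: (FPP i) => [/Phi_ge0|/Psi_ge0].
- by apply: prodr_ge0 => i _; exact: I_ge0.
- move=> f pf; pose G i := if i == j then f else F i.
  have GF i : i != j -> G i = F i by rewrite /G => /negbTE->.
  have Gj : G j = f by rewrite /G eqxx.
  have := ih (ltnW kn) G; under eq_integral do rewrite (dec G)// Gj.
  rewrite (bigD1 j)//= Gj mulrC.
  under eq_bigr => i ij do rewrite GF//.
  apply.
  + move=> i ik; rewrite GF; first by apply: F1; rewrite ltnS ltnW.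
    by apply: contraTneq ik => ->; rewrite ltnn.
  + move=> i ik; have [->|ij] := eqVneq i j; first by rewrite Gj.
    by rewrite GF//; apply: F2; case: (Pj _ ij) => //; rewrite ltnNge ik.
- exact: F1.
Qed.

End replacement.

Section mgf_consequences.
Context {R : realType} (d : measure_display) (T : measurableType d).
Variable P : probability T R.

Lemma gaussian_mgf (X : T -> R) (v a : R) : is_gaussian P X 0 v ->
  (\int[P]_w (expR (a * X w))%:E = (expR (v * a ^+ 2 / 2))%:E)%E.
Proof.
move=> [mX [v0 h]].
have mE : measurable_fun setT (fun x : R => (expR (a * x))%:E).
  by apply/measurable_EFinP/measurable_expRM.
have E0 (x : R) : (0 <= (expR (a * x))%:E :> \bar R)%E by rewrite lee_fin expR_ge0.
transitivity (\int[image_measure _ _ _ _ _ P _ mX]_x (expR (a * x))%:E)%E.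
  by rewrite ge0_integral_image.
move: h; rewrite /gaussian_law; case: ifPn => [/eqP -> h|vn0 h].
  rewrite !mul0r expR0.
  pose z : R := 0.
  transitivity (\int[\d_z]_x (expR (a * x))%:E)%E.
    by apply: eq_measure_integral => A mA _; exact: h.
  by rewrite integral_dirac//= diracT mul1e /z mulr0 expR0.
transitivity (\int[normal_law (Num.sqrt v)]_x (expR (a * x))%:E)%E.
  by apply: eq_measure_integral => A mA _; exact: h.
by rewrite normal_mgf ?sqr_sqrtr// sqrtr_eq0 -ltNge lt_neqAle eq_sym vn0.
Qed.

(** Integrability and value are kept together, so that one linear computation yields both. *)
Definition has_mean (f : T -> R) (r : R) : Prop :=
  P.-integrable setT (fun w => (f w)%:E) /\ (\int[P]_w (f w)%:E = r%:E)%E.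

Lemma has_mean_cst r : has_mean (fun=> r) r.
Proof.
split; first exact: finite_measure_integrable_cst.
by have := expectation_cst P r; rewrite unlock.
Qed.

Lemma has_meanZ a f r : has_mean f r -> has_mean (fun w => a * f w) (a * r).
Proof.
move=> [fi fr]; split.
  by under eq_fun do rewrite EFinM; exact: integrableZl.
by under eq_integral do rewrite EFinM; rewrite integralZl// fr EFinM.
Qed.

Lemma has_mean_sum (I : Type) (s : seq I) (Q : pred I) (f : I -> T -> R) (r : I -> R) :
  (forall i, has_mean (f i) (r i)) ->
  has_mean (fun w => \sum_(i <- s | Q i) f i w) (\sum_(i <- s | Q i) r i).
Proof.
move=> h; split.
  under eq_fun do rewrite -sumEFin.
  by apply: integrable_sum => // i _; case: (h i).
under eq_integral do rewrite -sumEFin.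
rewrite integral_sum//; last by move=> i; case: (h i).
by rewrite -sumEFin; apply: eq_bigr => i _; case: (h i).
Qed.

Lemma has_meanD f g r s : has_mean f r -> has_mean g s ->
  has_mean (fun w => f w + g w) (r + s).
Proof.
move=> [fi fr] [gi gs]; split.
  by under eq_fun do rewrite EFinD; exact: integrableD.
by under eq_integral do rewrite EFinD; rewrite integralD// fr gs.
Qed.

Lemma has_meanB f g r s : has_mean f r -> has_mean g s ->
  has_mean (fun w => f w - g w) (r - s).
Proof.
move=> hf /(has_meanZ (-1)) hg; rewrite -mulN1r.
have := has_meanD _ _ _ _ hf hg.
by under eq_fun do rewrite mulN1r.
Qed.

Lemma ge0_has_mean (f : T -> R) r : measurable_fun setT f -> (forall w, 0 <= f w) ->
  (\int[P]_w (f w)%:E = r%:E)%E -> has_mean f r.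
Proof.
move=> mf f0 fr; split => //; apply/integrableP; split.
  exact/measurable_EFinP.
by under eq_integral do rewrite gee0_abs ?lee_fin//; rewrite fr ltry.
Qed.

(** The symmetric second difference quotient at 0 of [a] mapped to [expR (a * Y)] tends to [Y ^+ 2].
    Dominated convergence equates its mean with the second derivative at 0 of the given generating
    function, which is [v]. *)
Lemma mgf_second_moment (Y : T -> R) (v : R) : measurable_fun setT Y ->
  (forall a, (\int[P]_w (expR (a * Y w))%:E = (expR (v * a ^+ 2 / 2))%:E)%E) ->
  has_mean (fun w => Y w ^+ 2) v.
Proof.
move=> mY h.
have iE a : has_mean (fun w => expR (a * Y w)) (expR (v * a ^+ 2 / 2)).
  by apply: ge0_has_mean => //; exact: measurable_expRM.
pose x n w : R := n.+1%:R^-1 * Y w / 2.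
(* [2 cosh (2 x) - 2 = (e^x - e^(-x))^2] makes the second difference quotient a square. *)
pose f_ n w := n.+1%:R ^+ 2 *
  (expR (n.+1%:R^-1 * Y w) + expR (- n.+1%:R^-1 * Y w) - 2).
pose e n w := n.+1%:R * (expR (x n w) - expR (- x n w)).
have fe n w : f_ n w = e n w ^+ 2.
  rewrite /f_ /e exprMn; congr (_ * _).
  have -> : n.+1%:R^-1 * Y w = x n w + x n w by rewrite /x -splitr.
  have -> : - n.+1%:R^-1 * Y w = - x n w + - x n w.
    by rewrite mulNr -opprD /x -splitr.
  transitivity (expR (x n w) ^+ 2 + expR (- x n w) ^+ 2 -
      2 * (expR (x n w) * expR (- x n w))); last by ring.
  by rewrite expRxMexpNx_1 mulr1 !expRD !expr2.
have n0 n : 0 < n.+1%:R :> R by [].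
have eY n w : `|e n w - Y w| <= n.+1%:R^-1 * (Y w ^+ 2 * expR `|Y w|).
  have -> : e n w - Y w = n.+1%:R * ((expR (x n w) - 1 - x n w) -
      (expR (- x n w) - 1 - (- x n w))).
    by rewrite /e /x; field; rewrite gt_eqF.
  rewrite normrM (ger0_norm (ltW (n0 n))).
  apply: (@le_trans _ _ (n.+1%:R * (2 * (x n w ^+ 2 * expR `|x n w|)))).
    rewrite ler_wpM2l ?(ltW (n0 n))//; apply: le_trans (ler_normB _ _) _.
    have := expR_taylor1 (x n w); have := expR_taylor1 (- x n w).
    by rewrite normrN sqrrN; lra.
  have -> : n.+1%:R * (2 * (x n w ^+ 2 * expR `|x n w|)) =
      n.+1%:R^-1 * (Y w ^+ 2 * (expR `|x n w| / 2)).
    by rewrite /x; field; rewrite gt_eqF.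
  rewrite ler_wpM2l ?invr_ge0 ?(ltW (n0 n))// ler_wpM2l ?sqr_ge0//.
  have : expR `|x n w| <= expR `|Y w|.
    rewrite ler_expR /x !normrM ger0_norm ?invr_ge0 ?(ltW (n0 n))//.
    rewrite [`|2^-1|]ger0_norm ?invr_ge0// -mulrA mulrCA.
    rewrite ler_piMr// mulr_ile1 ?invr_ge0//; first by rewrite invf_le1// ler1n.
    by rewrite invf_le1// ler1n.
  by have := expR_ge0 `|x n w|; lra.
(* The square root [e] of the quotient satisfies [|e| <= |Y| + Y^2 exp |Y| <= 3 (exp |Y|)^2];
   squaring gives the constant 9 and the rate 4. *)
have dom n w : `|f_ n w| <= 9 * (expR (4 * Y w) + expR (- 4 * Y w)).
  rewrite fe normrX.
  have E1 : 1 <= expR `|Y w| by rewrite -expR0 ler_expR.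
  have he : `|e n w| <= 3 * expR `|Y w| ^+ 2.
    have h1 := normX_le_expR (Y w) 1; have h2 := normX_le_expR (Y w) 2.
    have h3 : `|e n w| <= `|Y w| + `|e n w - Y w|.
      by rewrite -{1}(subrK (Y w) (e n w)) addrC; exact: ler_normD.
    have h4 : `|e n w - Y w| <= Y w ^+ 2 * expR `|Y w|.
      apply: le_trans (eY n w) _.
      rewrite ler_piMl 1?mulr_ge0 ?sqr_ge0 ?expR_ge0//.
      by rewrite invf_le1// ler1n.
    move: h1 h2; rewrite expr1 mul1r !factS fact0 !muln1.
    rewrite -normrX (ger0_norm (sqr_ge0 _)) expr2 => h1 h2.
    have h5 : Y w ^+ 2 * expR `|Y w| <= 2 * expR `|Y w| * expR `|Y w|.
      by rewrite ler_wpM2r ?expR_ge0.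
    by nra.
  have h6 : expR (4 * `|Y w|) = expR `|Y w| ^+ 4 by rewrite expRM_natl.
  have h7 : expR (4 * `|Y w|) <= expR (4 * Y w) + expR (- 4 * Y w).
    apply: le_trans (_ : expR `|4 * Y w| <= _).
      by rewrite normrM ger0_norm.
    by apply: le_trans (expR_norm_le _) _; rewrite mulNr.
  apply: (@le_trans _ _ ((3 * expR `|Y w| ^+ 2) ^+ 2)).
    by rewrite ler_pXn2r// nnegrE// mulr_ge0// exprn_ge0// expR_ge0.
  apply: (@le_trans _ _ (9 * expR (4 * `|Y w|))); last by rewrite ler_wpM2l.
  by rewrite h6 le_eqVlt; apply/orP; left; apply/eqP; ring.
have f_int n := has_meanZ (n.+1%:R ^+ 2) _ _ (has_meanB _ _ _ _
  (has_meanD _ _ _ _ (iE n.+1%:R^-1) (iE (- n.+1%:R^-1))) (has_mean_cst 2)).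
have mf_ n : measurable_fun setT (fun w => (f_ n w)%:E).
  exact: measurable_int (f_int n).1.
have mY2 : measurable_fun setT (fun w => (Y w ^+ 2)%:E).
  by apply/measurable_EFinP; exact: measurable_funX.
have cvf w : (f_ n w)%:E @[n --> \oo] --> (Y w ^+ 2)%:E.
  apply: cvg_EFin; first exact: nearW.
  under eq_fun do rewrite fe.
  have cve : e n w @[n --> \oo] --> Y w.
    apply/cvgrPdist_le => t t0; set B := Y w ^+ 2 * expR `|Y w|.
    have : harmonic n * B @[n --> \oo] --> (0 * B : R).
      by apply: cvgMl; exact: cvg_harmonic.
    rewrite mul0r => /cvgr0Pnorm_le/(_ _ t0); apply: filterS => n.
    move=> hn; rewrite distrC; apply: le_trans (eY n w) _.
    by apply: le_trans (ler_norm _) hn.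
  by rewrite expr2; under eq_fun do rewrite expr2; exact: cvgM.
have [iY _ cY] := @dominated_convergence _ _ _ P setT measurableT
  (fun n w => (f_ n w)%:E) (fun w => (Y w ^+ 2)%:E)
  (fun w => (9 * (expR (4 * Y w) + expR (- 4 * Y w)))%:E) mf_ mY2
  (aeW _ (fun w _ => cvf w))
  (has_meanZ 9 _ _ (has_meanD _ _ _ _ (iE 4) (iE (-4)))).1
  (aeW _ (fun w n _ => dom n w)).
split => //; rewrite -(cvg_lim _ cY)//; apply/cvg_lim => //.
under eq_cvg do rewrite /= (f_int _).2.
apply: cvg_EFin; first exact: nearW.
apply/cvgrPdist_le => t t0; set B := v ^+ 2 * expR `|v|.
have : harmonic n * B @[n --> \oo] --> (0 * B : R).
  by apply: cvgMl; exact: cvg_harmonic.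
rewrite mul0r => /cvgr0Pnorm_le/(_ _ t0); apply: filterS => n.
move=> hn; rewrite distrC; apply: le_trans (le_trans (ler_norm _) hn).
pose z := v * n.+1%:R^-1 ^+ 2 / 2.
have -> : n.+1%:R ^+ 2 * (expR (v * n.+1%:R^-1 ^+ 2 / 2) +
    expR (v * (- n.+1%:R^-1) ^+ 2 / 2) - 2) - v =
    n.+1%:R ^+ 2 * 2 * (expR z - 1 - z).
  by rewrite sqrrN -/z [in RHS]/z; field; rewrite gt_eqF.
rewrite normrM ger0_norm ?mulr_ge0 ?sqr_ge0//.
apply: le_trans (ler_wpM2l _ (expR_taylor1 z)) _; first by rewrite mulr_ge0 ?sqr_ge0.
have n1 : n.+1%:R^-1 <= 1 :> R by rewrite invf_le1// ler1n.
have nV0 : 0 <= n.+1%:R^-1 :> R by rewrite invr_ge0.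
have -> : n.+1%:R ^+ 2 * 2 * (z ^+ 2 * expR `|z|) =
    n.+1%:R^-1 * (v ^+ 2 * (n.+1%:R^-1 / 2 * expR `|z|)).
  by rewrite /z; field; rewrite gt_eqF.
rewrite /harmonic /= /B ler_wpM2l// ler_wpM2l ?sqr_ge0//.
have : expR `|z| <= expR `|v|.
  rewrite ler_expR /z normrM normrM [`|_ ^+ 2|]ger0_norm ?sqr_ge0//.
  rewrite [`|2^-1|]ger0_norm// -mulrA ler_piMr// mulr_ile1 ?sqr_ge0//.
    by rewrite exprn_ile1.
  by rewrite invf_le1// ler1n.
move/(le_trans _); apply; rewrite ler_piMl ?expR_ge0// mulr_ile1//.
by rewrite invf_le1// ler1n.
Qed.

(** Here [replace_all] starts from indicators, for which the product formula is independence itself,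
    and arrives at exponentials. *)
Lemma indep_mgf (n : nat) (Y : 'I_n -> T -> R) (a m : 'I_n -> R) :
  (forall i, measurable_fun setT (Y i)) ->
  (forall B : 'I_n -> set R, (forall i, measurable (B i)) ->
    P (\bigcap_(i in [set: 'I_n]) (Y i @^-1` B i)) =
    (\prod_(i < n) P (Y i @^-1` B i))%E) ->
  (forall i, (\int[P]_w (expR (a i * Y i w))%:E = (m i)%:E)%E) ->
  (\int[P]_w (\prod_i expR (a i * Y i w))%:E = (\prod_i m i)%:E)%E.
Proof.
move=> mY indep hm.
pose M i (f : R -> R) := fine (\int[P]_w (f (Y i w))%:E)%E.
pose Phi (i : 'I_n) := [set f : R -> R | exists2 B : set R, measurable B & f = \1_B].
pose Psi (i : 'I_n) := [set f : R -> R | f = fun x => expR (a i * x)].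
have mPre i (B : set R) : measurable B -> measurable (Y i @^-1` B).
  by move=> mB; rewrite -[X in measurable X]setTI; exact: mY.
have M1 i (B : set R) : measurable B -> M i \1_B = fine (P (Y i @^-1` B)).
  move=> mB; rewrite /M; congr fine.
  rewrite -[X in P X]setIT -integral_indic; first by apply: eq_integral.
    by [].
  exact: mPre.
have start F : (forall i, Phi i (F i)) ->
    (\int[P]_w (\prod_i F i (Y i w))%:E = (\prod_i M i (F i))%:E)%E.
  move=> hF.
  have [B hB] : {B : 'I_n -> set R & forall i, measurable (B i) /\ F i = \1_(B i)}.
    apply: (@choice _ _ (fun i (B : set R) => measurable B /\ F i = \1_B)) => i.
    by have [B mB FB] := hF i; exists B.
  have mB i := (hB i).1.
  have -> : (\prod_i M i (F i))%:E = (\prod_i P (Y i @^-1` B i))%E.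
    rewrite -prodEFin; apply: eq_bigr => i _; rewrite (hB i).2 M1//.
    by rewrite fineK// fin_num_measure//; exact: mPre.
  rewrite -indep// -[X in P X]setIT -integral_indic//; last first.
    by apply: fin_bigcap_measurable => // i _; exact: mPre.
  apply: eq_integral => w _; congr EFin.
  under eq_bigr do rewrite (hB _).2 indicE.
  rewrite indicE; case: (boolP (w \in _)) => [|/negP] wB.
    rewrite big1// => i _; rewrite mem_set//.
    by move: wB; rewrite inE => /(_ i I).
  apply/eqP/prodf_eq0.
  have [i hi] : exists i, ~ B i (Y i w).
    by apply/existsNP => hi; apply: wB; rewrite inE => i _; exact: hi.
  by exists i => //; rewrite memNset.
have := @replace_all R d T P n Y mY Phi Psi M _ _ _ _ _ _ start
  (fun i x => expR (a i * x)) (fun i => erefl).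
have -> : \prod_i m i = \prod_i M i (fun x => expR (a i * x)).
  by apply: eq_bigr => i _; rewrite /M hm.
apply => //.
- by move=> i _ [B mB ->]; exact: measurable_indic.
- by move=> i _ [B mB ->] x; rewrite indicE.
- by move=> i _ ->; exact: measurable_expRM.
- by move=> i _ -> x; exact: expR_ge0.
- move=> i f [[B mB ->]|->]; apply: fine_ge0; apply: integral_ge0 => w _.
    by rewrite lee_fin indicE.
  by rewrite lee_fin expR_ge0.
- move=> i H k mH H0 k0 hk _ ->.
  have mlaw := mY i.
  have -> := weighted_law_eq _ _ P _ mlaw H k (image_measure _ _ _ _ _ P _ mlaw)
    mH H0 k0 _ (fun x => expR (a i * x)).
  + rewrite ge0_integral_image.
    * by rewrite hm /M hm -EFinM.
    * exact/measurable_EFinP/measurable_expRM.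
    * by move=> x; rewrite lee_fin expR_ge0.
  + move=> A mA; rewrite hk; last by exists A.
    by rewrite M1// EFinM fineK// fin_num_measure//; exact: mPre.
  + exact: measurable_expRM.
  + by move=> x; exact: expR_ge0.
Qed.

(** The opposite direction: the hypothesis is the product formula for exponentials, and
    [weighted_gaussian] exchanges one of them for an arbitrary nonnegative function of finite normal
    mean. *)
Lemma gaussian_vector_prod (n : nat) (z : 'I_n -> T -> R) (F : 'I_n -> R -> R)
    (r : 'I_n -> R) :
  (forall i, measurable_fun setT (z i)) ->
  (forall a : 'I_n -> R, (\int[P]_w (expR (\sum_i a i * z i w))%:E =
     (expR (\sum_i a i ^+ 2 / 2))%:E)%E) ->
  (forall i, measurable_fun setT (F i)) -> (forall i x, 0 <= F i x) ->
  (forall i, (\int[normal_law 1]_x (F i x)%:E = (r i)%:E)%E) ->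
  (\int[P]_w (\prod_i F i (z i w))%:E = (\prod_i r i)%:E)%E.
Proof.
move=> mz hz mF F0 hF.
pose M (i : 'I_n) (f : R -> R) := fine (\int[normal_law 1]_x (f x)%:E)%E.
pose Phi (i : 'I_n) := [set f : R -> R | exists a, f = fun x => expR (a * x)].
pose Psi (i : 'I_n) := [set f : R -> R | f = F i].
have ME i a : M i (fun x => expR (a * x)) = expR (a ^+ 2 / 2).
  by rewrite /M normal_mgf ?oner_neq0// expr1n mul1r.
have start G : (forall i, Phi i (G i)) ->
    (\int[P]_w (\prod_i G i (z i w))%:E = (\prod_i M i (G i))%:E)%E.
  move=> /choice[a ha].
  under eq_integral.
    move=> w _; under eq_bigr do rewrite ha.
    rewrite -expR_sum; over.
  rewrite hz expR_sum; congr EFin; apply: eq_bigr => i _.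
  by rewrite ha ME.
have := @replace_all R d T P n z mz Phi Psi M _ _ _ _ _ _ start F (fun i => erefl).
have -> : \prod_i r i = \prod_i M i (F i).
  by apply: eq_bigr => i _; rewrite /M hF.
apply => //.
- by move=> i _ [a ->]; exact: measurable_expRM.
- by move=> i _ [a ->] x; exact: expR_ge0.
- by move=> i _ ->.
- by move=> i _ -> x.
- move=> i f [[a ->]|->]; first by rewrite ME expR_ge0.
  by apply: fine_ge0; apply: integral_ge0 => x _; rewrite lee_fin.
- move=> i H k mH H0 k0 hk _ ->.
  rewrite (weighted_gaussian _ _ P _ (mz i) H k mH H0 k0 _ (F i))//.
    by rewrite hF /M hF -EFinM.
  move=> a; have := hk (fun x => expR (a * x)); rewrite ME; apply.
  by exists a.
Qed.

End mgf_consequences.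

Section sigma_finite_measure.
Context (R : realType) (d : measure_display) (T : measurableType d).
Variable mu : {measure set T -> \bar R}.
Hypothesis sf : sigma_finite setT mu.

(** A copy of [mu] in which sigma-finiteness, so far a proposition, becomes part of the structure
    that Tonelli's theorem expects. *)
Definition sfmeasure & sigma_finite setT mu : set T -> \bar R := mu.

HB.instance Definition _ := Measure.copy (sfmeasure sf) mu.
HB.instance Definition _ := Measure_isSigmaFinite.Build _ _ _ (sfmeasure sf) sf.

End sigma_finite_measure.

Lemma tonelli_sigma_finite {R : realType} (d1 d2 : measure_display)
    (T1 : measurableType d1) (T2 : measurableType d2)
    (m1 : {measure set T1 -> \bar R}) (m2 : {measure set T2 -> \bar R})
    (f : T1 -> T2 -> R) :
  sigma_finite setT m1 -> sigma_finite setT m2 ->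
  measurable_fun setT (fun p : T1 * T2 => f p.1 p.2) ->
  (forall x y, 0 <= f x y) ->
  (\int[m1]_x \int[m2]_y (f x y)%:E = \int[m2]_y \int[m1]_x (f x y)%:E)%E.
Proof.
move=> s1 s2 mf f0.
have := @fubini_tonelli _ _ T1 T2 R (sfmeasure _ _ _ _ s1) (sfmeasure _ _ _ _ s2)
  (fun p => (f p.1 p.2)%:E).
apply.
- exact/measurable_EFinP.
- by move=> p; rewrite lee_fin.
Qed.

(** * Factorisation of positive definite matrices *)

Section cholesky.
Context {R : rcfType}.

Definition qform n (C : 'M[R]_n) (x : 'cV[R]_n) : R := (x^T *m C *m x) ord0 ord0.

Lemma qform_block n a (b : 'cV[R]_n) (C : 'M[R]_n) (y : R) (x : 'cV[R]_n) :
  qform (1 + n) (block_mx a%:M b^T b C) (col_mx y%:M x) =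
  a * y ^+ 2 + 2 * y * (b^T *m x) ord0 ord0 + qform n C x.
Proof.
have tb : (x^T *m b) ord0 ord0 = (b^T *m x) ord0 ord0.
  by rewrite -[x^T *m b]trmxK trmx_mul trmxK mxE.
rewrite /qform tr_col_mx mul_row_block mul_row_col tr_scalar_mx.
rewrite mul_mx_scalar !mul_scalar_mx mulmxDl -scalemxAl.
move: tb; move: (x^T *m b) (b^T *m x) (x^T *m C *m x) => p q r pq.
by rewrite !mxE pq /= mulr1n; ring.
Qed.

(** Induction through the Schur complement [S] of the upper left entry [a]: if [S = M' M'^T], then
    the factor of [C] has diagonal blocks [s] and [M'], with [s] the square root of [a], and lower
    left block [b / s]. *)
Lemma cholesky n (C : 'M[R]_n) : C^T = C ->
  (forall x, x != 0 -> 0 < qform n C x) ->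
  exists2 M : 'M[R]_n, M \in unitmx & C = M *m M^T.
Proof.
elim: n C => [|n ih] C Cs Cp.
  by exists 1%:M; rewrite ?unitmx1// trmx1 mulmx1 [LHS]flatmx0 [RHS]flatmx0.
pose C' : 'M[R]_(1 + n) := C.
pose a := (ulsubmx C') ord0 ord0; pose b := dlsubmx C'; pose D := drsubmx C'.
have CE : C' = block_mx a%:M b^T b D.
  rewrite -[LHS]submxK /b /D trmx_dlsub Cs -/C'; congr (block_mx _ _ _ _).
  exact: mx11_scalar.
have Ds : D^T = D by rewrite /D trmx_drsub Cs.
have Cp' (y : R) (x : 'cV[R]_n) : col_mx y%:M x != 0 ->
    0 < a * y ^+ 2 + 2 * y * (b^T *m x) ord0 ord0 + qform n D x.
  by move=> /Cp; rewrite -[C]/C' CE qform_block.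
have a0 : 0 < a.
  have := Cp' 1 0; rewrite mulmx0 /qform mulmx0 !mxE !mulr0 !addr0 expr1n mulr1.
  apply; rewrite -col_mx0; apply/eqP => /eq_col_mx[+ _].
  move=> /(congr1 (fun A : 'M[R]_1 => A ord0 ord0)).
  by rewrite !mxE /= => /eqP; rewrite oner_eq0.
pose S := D - a^-1 *: (b *m b^T).
have [M' M'u SE] : exists2 M : 'M[R]_n, M \in unitmx & S = M *m M^T.
  apply: ih.
    by rewrite /S linearB linearZ /= trmx_mul trmxK Ds.
  move=> x x0; pose q := (b^T *m x) ord0 ord0.
  (* This value of the first coordinate minimises the form of [C] for fixed [x]; the minimum is the
     form of [S]. *)
  have := Cp' (- a^-1 * q) x; rewrite -/q => h.
  have -> : qform n S x = a * (- a^-1 * q) ^+ 2 + 2 * (- a^-1 * q) * q + qform n D x.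
    rewrite /qform /S mulmxBr mulmxBl -scalemxAr -scalemxAl.
    have -> : x^T *m (b *m b^T) *m x = (x^T *m b) *m (b^T *m x) by rewrite !mulmxA.
    have tb : (x^T *m b) ord0 ord0 = q.
      by rewrite -[x^T *m b]trmxK trmx_mul trmxK mxE.
    move: (x^T *m D *m x) => r; rewrite mxE [X in _ + X]mxE [X in - X]mxE.
    by rewrite [X in a^-1 * X]mxE big_ord1 tb -/q; field; rewrite gt_eqF.
  apply: h; rewrite -col_mx0; apply: contra x0 => /eqP/eq_col_mx[_ ->].
  by [].
pose s := Num.sqrt a.
have s0 : s != 0 by rewrite sqrtr_eq0 -ltNge.
have ss : s * s = a by rewrite -expr2 sqr_sqrtr// ltW.
pose L : 'M[R]_(1 + n) := block_mx s%:M 0 (s^-1 *: b) M'.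
have LE : C' = L *m L^T.
  rewrite CE /L tr_block_mx mulmx_block; congr (block_mx _ _ _ _).
  - by rewrite mul0mx addr0 tr_scalar_mx -scalar_mxM ss.
  - by rewrite mul0mx addr0 linearZ /= mul_scalar_mx scalerA divff// scale1r.
  - rewrite trmx0 mulmx0 addr0 tr_scalar_mx mul_mx_scalar scalerA divff//.
    by rewrite scale1r.
  - rewrite linearZ /= -scalemxAl -scalemxAr scalerA -invfM ss -SE /S.
    by rewrite addrC subrK.
exists L; last exact: LE.
have dE : \det L = s * \det M' by rewrite /L det_lblock det_scalar expr1.
rewrite unitmxE; apply: (@eq_ind_r _ _ (fun t => t \is a GRing.unit) _ _ dE).
by rewrite unitrM unitfE s0 -unitmxE.
Qed.

End cholesky.

(** * Lebesgue measure on tuples *)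

Section tuple_lebesgue.
Context {R : realType} {n : nat}.
Local Notation leb := (@lebesgue_measure R).

Definition colv (x : n.-tuple R) : 'cV[R]_n := \col_i tnth x i.

Definition aff (A : 'M[R]_n) (u : 'cV[R]_n) (x : n.-tuple R) : n.-tuple R :=
  [tuple (A *m colv x + u) i ord0 | i < n].

Lemma colv_aff A u x : colv (aff A u x) = A *m colv x + u.
Proof. by apply/colP => i; rewrite mxE tnth_mktuple. Qed.

Lemma colv_inj : injective colv.
Proof.
by move=> x y /colP h; apply: eq_from_tnth => i; have := h i; rewrite !mxE.
Qed.

Lemma affK A u : A \in unitmx ->
  cancel (aff A u) (aff (invmx A) (- (invmx A *m u))).
Proof.
by move=> Au x; apply: colv_inj; rewrite !colv_aff mulmxDr mulKmx// addrK.
Qed.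

Lemma aff_comp A u B v x : aff A u (aff B v x) = aff (A *m B) (A *m v + u) x.
Proof. by apply: colv_inj; rewrite !colv_aff mulmxDr mulmxA addrA. Qed.

Lemma measurable_aff A u : measurable_fun setT (aff A u).
Proof.
apply/measurable_fun_tnthP => i.
rewrite (_ : _ \o _ = fun x => \sum_j A i j * tnth x j + u i ord0).
  apply: measurable_funD => //; apply: measurable_sum => j.
  by apply: measurable_funM => //; exact: measurable_tnth.
apply/funext => x /=; rewrite tnth_mktuple !mxE; congr (_ + _).
by apply: eq_bigr => j _; rewrite mxE.
Qed.

Lemma measurable_aff2 (A B : 'M[R]_n) : measurable_fun setT
  (fun p : n.-tuple R * n.-tuple R => aff A (B *m colv p.1) p.2).
Proof.
apply/measurable_fun_tnthP => i.
rewrite (_ : _ \o _ = fun p : n.-tuple R * n.-tuple R =>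
  \sum_j A i j * tnth p.2 j + \sum_j B i j * tnth p.1 j).
  apply: measurable_funD; apply: measurable_sum => j; apply: measurable_funM => //.
    exact: (measurableT_comp (measurable_tnth j) measurable_snd).
  exact: (measurableT_comp (measurable_tnth j) measurable_fst).
apply/funext => p /=; rewrite tnth_mktuple !mxE; congr (_ + _).
  by apply: eq_bigr => j _; rewrite mxE.
by apply: eq_bigr => j _; rewrite mxE.
Qed.

Definition box (B : 'I_n -> set R) : set (n.-tuple R) :=
  [set x | forall i, B i (tnth x i)].

Lemma boxE B : box B = \bigcap_(i in [set: 'I_n]) ((fun x : n.-tuple R => tnth x i) @^-1` B i).
Proof. by apply/seteqP; split => x h i => [_|]; exact: h. Qed.

Lemma measurable_box (B : 'I_n -> set R) : (forall i, measurable (B i)) -> measurable (box B).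
Proof.
move=> mB; rewrite boxE; apply: fin_bigcap_measurable => // i _.
by rewrite -[X in measurable X]setTI; exact: measurable_tnth.
Qed.

(** The sides are arbitrary Borel sets of finite measure, not only the closed intervals of
    [lebesgue_tuple]: such boxes are stable under intersection, and the real-valued lengths [l]
    avoid products of 0 and infinity. *)
Definition box_lebesgue (nu : set (n.-tuple R) -> \bar R) : Prop :=
  forall (B : 'I_n -> set R) (l : 'I_n -> R), (forall i, measurable (B i)) ->
  (forall i, leb (B i) = (l i)%:E) -> nu (box B) = (\prod_i l i)%:E.

Definition cube (k : nat) : set (n.-tuple R) :=
  box (fun=> `[- k%:R, k%:R]%classic).

Lemma lebesgue_itv_cube (k : nat) : leb `[- (k%:R : R), k%:R]%classic = (k%:R *+ 2)%:E.
Proof.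
have k0 : 0 <= k%:R :> R by [].
rewrite lebesgue_measure_itv /= lte_fin; case: ltP => h.
  by rewrite -EFinB opprK mulr2n.
have -> : k%:R = 0 :> R by lra.
by rewrite mul0rn.
Qed.

Lemma bigcup_cube : \bigcup_k cube k = setT.
Proof.
rewrite -subTset => x _; exists (\max_i Num.bound `|tnth x i|)%N => // i /=.
rewrite in_itv /= -ler_norml.
apply: le_trans (ltW (archi_boundP (normr_ge0 _))) _.
by rewrite ler_nat (leq_bigmax i).
Qed.

Lemma box_lebesgue_cube nu k : box_lebesgue nu -> nu (cube k) = (\prod_(i < n) (k%:R *+ 2))%:E.
Proof. by move=> h; apply: h => // _; exact: lebesgue_itv_cube. Qed.

Lemma box_sigma_algebra : @measurable _ (n.-tuple R) =
  <<s [set A | exists (B : 'I_n -> set R) (l : 'I_n -> R),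
    [/\ forall i, measurable (B i), forall i, leb (B i) = (l i)%:E & A = box B]] >>.
Proof.
set G := [set A | _].
apply/seteqP; split; last first.
  apply: smallest_sub; first exact: sigma_algebra_measurable.
  by move=> _ [B [l [mB _ ->]]]; exact: measurable_box.
suff : measurable_fun setT (id : g_sigma_algebraType G -> n.-tuple R).
  by move=> h A mA; have := h measurableT A mA; rewrite setTI.
apply/measurable_fun_tnthP => i _ A mA; rewrite setTI.
pose I k : set R := `[- k%:R, k%:R]%classic.
(* Truncation by [I k] in every coordinate keeps the sides of finite measure; the cylinder over [A]
   is the union over [k]. *)
pose B k j := if j == i then A `&` I k else I k.
rewrite (_ : _ @^-1` A = \bigcup_k box (B k)).
  apply: bigcupT_measurable => k; apply: sub_sigma_algebra.
  have mB j : measurable (B k j).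
    by rewrite /B; case: ifP => _; [apply: measurableI|]; rewrite ?/I.
  exists (B k), (fun j => fine (leb (B k j))); split => // j.
  rewrite fineK// ge0_fin_numE//; apply: (@le_lt_trans _ _ (leb (I k))).
    apply: le_measure; rewrite ?inE; [exact: mB|exact: measurable_itv|].
    by rewrite /B; case: ifP => _ // x [].
  by rewrite lebesgue_itv_cube ltry.
apply/seteqP; split => x.
  move=> Ax; have [k _ hk] : (\bigcup_k cube k) x by rewrite bigcup_cube.
  by exists k => // j; rewrite /B; have := hk j; case: eqP => [->|//].
by move=> [k _ /(_ i)]; rewrite /B eqxx => -[].
Qed.

Lemma box_lebesgue_unique (nu1 nu2 : {measure set (n.-tuple R) -> \bar R}) :
  box_lebesgue nu1 -> box_lebesgue nu2 ->
  forall A, measurable A -> nu1 A = nu2 A.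
Proof.
move=> h1 h2 A mA.
apply: (measure_unique _ cube box_sigma_algebra _ _ bigcup_cube) => //.
- move=> _ _ [B [l [mB fB ->]]] [C [l' [mC fC ->]]].
  have mBC i : measurable (B i `&` C i) by exact: measurableI.
  exists (fun i => B i `&` C i), (fun i => fine (leb (B i `&` C i))); split => //.
  + move=> i; rewrite fineK// ge0_fin_numE//.
    apply: (@le_lt_trans _ _ (leb (B i))); last by rewrite fB ltry.
    by apply: le_measure; rewrite ?inE//; [exact: mBC|exact: mB].
  + apply/seteqP; split => x.
      by move=> [hB hC] i; split; [exact: hB|exact: hC].
    by move=> h; split => i; have [] := h i.
- move=> k; exists (fun=> `[- k%:R, k%:R]%classic), (fun=> k%:R *+ 2); split => // _.
  exact: lebesgue_itv_cube.
- by move=> _ [B [l [mB fB ->]]]; rewrite (h1 _ l)// (h2 _ l).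
- by move=> k; rewrite box_lebesgue_cube// ltry.
Qed.

Lemma box_lebesgue_closed (nu : {measure set (n.-tuple R) -> \bar R}) :
  box_lebesgue nu -> lebesgue_tuple nu.
Proof.
move=> h a b ab.
have -> : [set x | forall i, a i <= tnth x i <= b i] = box (fun i => `[a i, b i]%classic).
  by apply/seteqP; split => x hx i; have := hx i; rewrite /= in_itv.
rewrite (h _ (fun i => b i - a i))// ?prodEFin//.
move=> i; rewrite lebesgue_measure_itv /= lte_fin; case: ltP => // ba.
by rewrite (le_anti (introT andP (conj ba (ab i)))) subrr.
Qed.

Lemma lebesgue_measure_shift (t : R) (A : set R) : measurable A ->
  leb ((fun x : R => x + t) @^-1` A) = leb A.
Proof.
move=> mA.
have mt : measurable_fun setT ((fun x => x + t) : measurableTypeR R -> measurableTypeR R).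
  exact: measurable_funD.
apply/esym; apply: (@lebesgue_measure_unique R
  (image_measure _ _ _ _ _ (@lebesgue_measure R) _ mt)) => //.
move=> _ [[a b] _ <-]; rewrite /image_measure /pushforward /=.
have -> : (fun x : R => x + t) @^-1` `]a, b]%classic = `]a - t, b - t]%classic.
  by apply/seteqP; split => x /=; rewrite !in_itv /= ltrBlDr lerBrDr.
rewrite !lebesgue_measure_itv /= !lte_fin ltrD2r.
by case: ifP => // _; rewrite -!EFinB; congr EFin; ring.
Qed.

Lemma box_lebesgue_shift (nu : {measure set (n.-tuple R) -> \bar R}) u :
  box_lebesgue nu ->
  box_lebesgue (image_measure _ _ _ _ _ nu _ (measurable_aff 1%:M u)).
Proof.
move=> h B l mB fB; rewrite /image_measure /pushforward.
pose B' i := (fun x => x + u i ord0) @^-1` B i.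
have -> : aff 1%:M u @^-1` box B = box B'.
  have e x i : tnth (aff 1%:M u x) i = tnth x i + u i ord0.
    by rewrite tnth_mktuple mul1mx !mxE.
  by apply/seteqP; split => x hx i; have := hx i; rewrite /B' /= e.
apply: h => i; last by rewrite -fB; exact: lebesgue_measure_shift.
rewrite -[X in measurable X]setTI; have : measurable_fun setT (fun x : R => x + u i ord0).
  exact: measurable_funD.
exact.
Qed.

Definition shift_invariant (nu : set (n.-tuple R) -> \bar R) : Prop :=
  forall u A, measurable A -> nu (aff 1%:M u @^-1` A) = nu A.

Lemma box_lebesgue_shift_invariant (nu : {measure set (n.-tuple R) -> \bar R}) :
  box_lebesgue nu -> shift_invariant nu.
Proof.
by move=> h u A mA; apply: (box_lebesgue_unique _ _ (box_lebesgue_shift _ u h) h).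
Qed.

Lemma box_lebesgue_sigma_finite (nu : {measure set (n.-tuple R) -> \bar R}) :
  box_lebesgue nu -> sigma_finite setT nu.
Proof.
move=> h; exists cube; first by rewrite bigcup_cube.
move=> k; split; first by apply: measurable_box.
by rewrite box_lebesgue_cube// ltry.
Qed.

Lemma integral_shift (nu : {measure set (n.-tuple R) -> \bar R}) u
    (f : n.-tuple R -> \bar R) : shift_invariant nu ->
  measurable_fun setT f -> (forall x, (0 <= f x)%E) ->
  (\int[nu]_x f (aff 1%:M u x) = \int[nu]_x f x)%E.
Proof.
move=> inv mf f0.
rewrite -(ge0_integral_image _ _ _ _ _ nu _ (measurable_aff 1%:M u))//.
by apply: eq_measure_integral => A mA _; exact: inv.
Qed.

(* Weil's argument for the uniqueness of Haar measure: evaluate the double integral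
   of 1_A(x) 1_K(y - x) in both orders. *)
Lemma shift_invariant_unique (mu nu : {measure set (n.-tuple R) -> \bar R})
    (A K : set (n.-tuple R)) :
  shift_invariant mu -> shift_invariant nu ->
  sigma_finite setT mu -> sigma_finite setT nu ->
  measurable A -> measurable K -> aff (- 1%:M) 0 @^-1` K = K ->
  (mu A * nu K = mu K * nu A)%E.
Proof.
move=> imu inu smu snu mA mK symK.
have mI B C u : measurable C ->
    measurable_fun setT (fun x => \1_C (aff B u x) : R).
  by move=> mC; apply: measurableT_comp (measurable_aff _ _); exact: measurable_indic.
pose f x y : R := \1_A x * \1_K (aff 1%:M (- 1%:M *m colv x) y).
pose g x y : R := \1_K x * \1_A (aff 1%:M (1%:M *m colv x) y).
have mJ B C D : measurable C -> measurable D -> measurable_fun setT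
    (fun p : n.-tuple R * n.-tuple R => \1_C p.1 * \1_D (aff 1%:M (B *m colv p.1) p.2) : R).
  move=> mC mD; apply: measurable_funM.
    by apply: measurableT_comp => //; exact: measurable_indic.
  apply: measurableT_comp (measurable_aff2 _ _); exact: measurable_indic.
have f0 x y : 0 <= f x y by rewrite mulr_ge0// indicE.
have g0 x y : 0 <= g x y by rewrite mulr_ge0// indicE.
have i0 C x : (0 <= (\1_C x : R)%:E)%E by rewrite lee_fin indicE.
have mE C : measurable C -> measurable_fun setT (fun x : n.-tuple R => (\1_C x : R)%:E).
  by move=> mC; apply/measurable_EFinP; exact: measurable_indic.
have inner B C D : measurable C -> measurable D ->
    (\int[mu]_x \int[nu]_y (\1_C x * \1_D (aff 1%:M (B *m colv x) y) : R)%:E =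
     mu C * nu D)%E.
  move=> mC mD.
  transitivity (\int[mu]_x ((\1_C x : R)%:E * nu D))%E.
    apply: eq_integral => x _; under eq_integral do rewrite EFinM.
    rewrite ge0_integralZl//.
    - rewrite (integral_shift nu _ (fun y => (\1_D y : R)%:E))//; last exact: mE.
      by rewrite integral_indic// setIT.
    - by apply/measurable_EFinP; exact: mI.
  by rewrite ge0_integralZr// ?integral_indic ?setIT//; exact: mE.
apply: etrans (etrans (esym (inner (- 1%:M) A K mA mK)) _) (inner 1%:M K A mK mA).
apply: etrans (tonelli_sigma_finite _ _ _ _ mu nu f smu snu (mJ _ _ _ mA mK) f0) _.
apply: etrans (esym (tonelli_sigma_finite _ _ _ _ mu nu g smu snu (mJ _ _ _ mK mA) g0)).
apply: eq_integral => y _.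
(* After replacing [x] by [x + y], [f x y] becomes [1_A(x + y) 1_K(- x)], which is [g x y] by the
   symmetry of [K]. *)
rewrite -(integral_shift mu (colv y) (fun x => (f x y)%:E))//; last 2 first.
- apply/measurable_EFinP; rewrite /f.
  apply: measurable_funM; first exact: measurable_indic.
  under eq_fun => x.
    rewrite (_ : aff _ _ y = aff (- 1%:M) (colv y) x); first over.
    by apply: colv_inj; rewrite !colv_aff mul1mx addrC.
  exact: mI.
- by move=> x; rewrite lee_fin.
apply: eq_integral => x _; rewrite /f /g mulrC; congr (_ * _)%:E.
  have -> : aff 1%:M (- 1%:M *m colv (aff 1%:M (colv y) x)) y = aff (- 1%:M) 0 x.
    apply: colv_inj; rewrite !colv_aff !mul1mx mulmxDr !mulNmx !mul1mx addr0.
    by rewrite addrCA subrr addr0.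
  rewrite !indicE; congr (nat_of_bool _)%:R.
  by rewrite -{2}symK; apply/idP/idP; rewrite !inE.
congr (\1_A _); apply: colv_inj; rewrite !colv_aff !mul1mx.
by rewrite addrC.
Qed.

End tuple_lebesgue.

Section gaussian_density.
Context {R : realType} (d : measure_display) (T : measurableType d).
Variables (P : probability T R) (n : nat) (Z : T -> n.-tuple R).
Hypothesis mZ : measurable_fun setT Z.
Hypothesis mgfZ : forall a : 'I_n -> R,
  (\int[P]_w (expR (\sum_i a i * tnth (Z w) i))%:E =
   (expR (\sum_i a i ^+ 2 / 2))%:E)%E.
Local Notation leb := (@lebesgue_measure R).

Lemma stdnormal_pdf_gt0 (x : R) : 0 < normal_pdf 0 1 x.
Proof.
rewrite normal_pdfE ?oner_neq0//.
by rewrite mulr_gt0 ?expR_gt0// normal_peak_gt0 ?oner_neq0.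
Qed.

Lemma measurable_stdnormal_pdfV :
  measurable_fun setT (fun x : R => (normal_pdf 0 1 x)^-1).
Proof.
apply: continuous_measurable_fun => x; apply: cvgV.
  by rewrite gt_eqF// stdnormal_pdf_gt0.
exact: (@continuous_normal_pdf R 0 1 (oner_neq0 _) x).
Qed.

Definition stdnormal_density (x : n.-tuple R) : R :=
  \prod_i normal_pdf 0 1 (tnth x i).

Local Notation phi := stdnormal_density.

Lemma stdnormal_density_gt0 x : 0 < phi x.
Proof. by apply: prodr_gt0 => i _; exact: stdnormal_pdf_gt0. Qed.

Lemma measurable_stdnormal_density : measurable_fun setT phi.
Proof.
apply: measurable_prod => i _.
exact: (measurableT_comp (measurable_normal_pdf 0 1) (measurable_tnth i)).
Qed.

Let mphiV : measurable_fun setT (fun x => (phi x)^-1).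
Proof.
rewrite (_ : (fun _ => _) = fun x => \prod_i (normal_pdf 0 1 (tnth x i))^-1).
  apply: measurable_prod => i _.
  exact: (measurableT_comp measurable_stdnormal_pdfV (measurable_tnth i)).
by apply/funext => x; rewrite prodfV.
Qed.

Let phiV_ge0 x : 0 <= (phi x)^-1.
Proof. by rewrite invr_ge0 ltW// stdnormal_density_gt0. Qed.

Definition gaussian_lebesgue : {measure set (n.-tuple R) -> \bar R} :=
  density_measure _ _ _ (image_measure _ _ _ _ _ P _ mZ) _ mphiV phiV_ge0.

Local Notation nu := gaussian_lebesgue.

Lemma ge0_integral_gaussian_lebesgue (f : n.-tuple R -> R) :
  measurable_fun setT f -> (forall x, 0 <= f x) ->
  (\int[P]_w (f (Z w))%:E = \int[nu]_x (f x * phi x)%:E)%E.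
Proof.
move=> mf f0.
have mfE : measurable_fun setT (fun x => (f x)%:E) by exact/measurable_EFinP.
rewrite [RHS]ge0_integral_density; last 2 first.
- apply/measurable_EFinP/measurable_funM => //.
  exact: measurable_stdnormal_density.
- by move=> x; rewrite lee_fin mulr_ge0// ltW// stdnormal_density_gt0.
under [RHS]eq_integral.
  move=> x _; rewrite -EFinM mulfK; last by rewrite gt_eqF// stdnormal_density_gt0.
  over.
by rewrite [RHS]ge0_integral_image// => x; rewrite lee_fin.
Qed.

Lemma gaussian_lebesgueP : box_lebesgue nu.
Proof.
move=> B l mB lB.
(* Dividing by the density makes the normal mean of [F i] the length of the side [B i]. *)
pose F i (x : R) := \1_(B i) x / normal_pdf 0 1 x.
have mV := measurable_stdnormal_pdfV.
have mF i : measurable_fun setT (F i).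
  by apply: measurable_funM => //; exact: measurable_indic.
have F0 i x : 0 <= F i x.
  by rewrite divr_ge0 ?normal_pdf_ge0// indicE.
have FE i : (\int[normal_law 1]_x (F i x)%:E = (l i)%:E)%E.
  rewrite integral_normal_law// -lB -[X in leb X]setIT.
  rewrite -integral_indic//; last exact: mB.
  apply: eq_integral => x _; rewrite /F divfK// gt_eqF//.
  exact: stdnormal_pdf_gt0.
rewrite -(gaussian_vector_prod _ _ P _ (fun i w => tnth (Z w) i) _ _ _ mgfZ mF F0 FE);
  last by move=> i; exact: (measurableT_comp (measurable_tnth i) mZ).
have mbox : measurable (box B) by exact: measurable_box.
transitivity (\int[nu]_x (\1_(box B) x : R)%:E)%E.
  by rewrite integral_indic// setIT.
rewrite [LHS]ge0_integral_density; last 2 first.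
- by apply/measurable_EFinP; exact: measurable_indic.
- by move=> x; rewrite lee_fin indicE.
rewrite ge0_integral_image; last 2 first.
- apply: emeasurable_funM; apply/measurable_EFinP; last exact: mphiV.
  exact: measurable_indic.
- by move=> x; rewrite -EFinM lee_fin mulr_ge0// indicE.
apply: eq_integral => w _; rewrite -EFinM; congr EFin.
rewrite /F big_split /= prodfV; congr (_ * _).
rewrite indicE; case: (boolP (_ \in _)) => [|/negP] wB.
  rewrite big1// => i _; rewrite indicE mem_set//.
  by move: wB; rewrite inE => /(_ i).
apply/esym/eqP/prodf_eq0.
have [i hi] : exists i, ~ B i (tnth (Z w) i).
  by apply/existsNP => hi; apply: wB; rewrite inE => i; exact: hi.
by exists i => //; rewrite indicE memNset.
Qed.

(** Ensures that the image of [gaussian_lebesgue] under [M] gives the unit cube finite mass, so that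
    the proportionality constant between the two measures is a real number. *)
Lemma cube_bounded_preimage (M : 'M[R]_n) : M \in unitmx ->
  exists k, aff M 0 @^-1` cube 1 `<=` cube k.
Proof.
move=> Mu; exists (\max_i Num.bound (\sum_j `|invmx M i j|))%N => x hx i.
rewrite /= in_itv /= -ler_norml.
have -> : tnth x i = \sum_j invmx M i j * tnth (aff M 0 x) j.
  have := colv_aff M 0 x; rewrite addr0 => /(congr1 (mulmx (invmx M))).
  rewrite mulKmx// => /colP/(_ i); rewrite !mxE => <-.
  by apply: eq_bigr => j _; rewrite mxE.
apply: le_trans (ler_norm_sum _ _ _) _.
apply: (@le_trans _ _ (\sum_j `|invmx M i j|)).
  apply: ler_sum => j _; rewrite normrM ler_piMr//.
  by have := hx j; rewrite /= in_itv /= -ler_norml.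
apply: le_trans (ltW (archi_boundP _)) _; first by apply: sumr_ge0.
by rewrite ler_nat (leq_bigmax i).
Qed.

(** The constant [k], mathematically the inverse of the absolute determinant of [M], is obtained as
    a ratio of masses of one cube. It is quantified before [u]: the density of [M Z + u] has the
    same factor for all shifts, hence for all parameters. *)
Lemma gaussian_affine_density (M : 'M[R]_n) : M \in unitmx ->
  exists2 k : R, 0 < k & forall u (f : n.-tuple R -> R),
    measurable_fun setT f -> (forall x, 0 <= f x) ->
    (\int[P]_w (f (aff M u (Z w)))%:E =
     \int[nu]_x (f x * (k * phi (aff (invmx M) (- (invmx M *m u)) x)))%:E)%E.
Proof.
move=> Mu; have hnu := gaussian_lebesgueP.
pose mu : {measure set (n.-tuple R) -> \bar R} :=
  image_measure _ _ _ _ _ nu _ (measurable_aff M 0).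
have inu := box_lebesgue_shift_invariant _ hnu.
have imu : shift_invariant mu.
  move=> u A mA; rewrite /mu /= /image_measure /pushforward.
  rewrite -[in RHS](inu (invmx M *m u)); last first.
    by rewrite -[X in measurable X]setTI; exact: measurable_aff.
  have e x : aff 1%:M u (aff M 0 x) = aff M 0 (aff 1%:M (invmx M *m u) x).
    by apply: colv_inj; rewrite !colv_aff !mul1mx mulmxDr mulKVmx// !addr0.
  by congr (nu _); apply/seteqP; split => x /=; rewrite e.
have snu := box_lebesgue_sigma_finite _ hnu.
have mcube k : measurable (cube k : set (n.-tuple R)) by exact: measurable_box.
have smu : sigma_finite setT mu.
  exists (fun k => aff (invmx M) 0 @^-1` cube k).
    by rewrite -preimage_bigcup bigcup_cube preimage_setT.
  move=> k; split; first by rewrite -[X in measurable X]setTI; exact: measurable_aff.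
  rewrite /mu /= /image_measure /pushforward -comp_preimage.
  rewrite (_ : _ @^-1` _ = cube k); first by rewrite box_lebesgue_cube// ltry.
  have := affK M 0 Mu; rewrite mulmx0 oppr0 => K.
  by apply/seteqP; split => x /=; rewrite K.
have muK : (mu (cube 1) < +oo)%E.
  have [k hk] := cube_bounded_preimage M Mu.
  apply: (@le_lt_trans _ _ (nu (cube k))).
    rewrite (_ : mu _ = nu (aff M 0 @^-1` cube 1))//.
    apply: le_measure; rewrite ?inE//.
    by rewrite -[X in measurable X]setTI; exact: measurable_aff.
  by rewrite box_lebesgue_cube// ltry.
pose K := \prod_(i < n) (1%:R *+ 2 : R).
have K0 : 0 < K by apply: prodr_gt0 => i _; rewrite pmulrn_lgt0.
pose k := fine (mu (cube 1)) / K.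
have k0 : 0 <= k by rewrite divr_ge0 ?(ltW K0)// fine_ge0.
have muE A : measurable A -> mu A = (k%:E * nu A)%E.
  move=> mA.
  have symK : aff (- 1%:M) 0 @^-1` cube 1 = cube 1 :> set (n.-tuple R).
    have e x i : tnth (aff (- 1%:M) 0 x) i = - tnth x i :> R.
      by rewrite tnth_mktuple mulNmx mul1mx addr0 !mxE.
    apply/seteqP; split => x hx i; have := hx i;
      by rewrite /= e !in_itv /= -!ler_norml normrN.
  have := shift_invariant_unique _ _ A (cube 1) imu inu smu snu mA (mcube 1%N) symK.
  rewrite (box_lebesgue_cube nu)// -/K => h.
  rewrite /k mulrC EFinM -muleA fineK; last by rewrite ge0_fin_numE.
  by rewrite -h muleCA -EFinM mulVf ?gt_eqF// mule1.
have main u (f : n.-tuple R -> R) :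
    measurable_fun setT f -> (forall x, 0 <= f x) ->
    (\int[P]_w (f (aff M u (Z w)))%:E =
     \int[nu]_x (f x * (k * phi (aff (invmx M) (- (invmx M *m u)) x)))%:E)%E.
  move=> mf f0.
  pose g x := f x * phi (aff (invmx M) (- (invmx M *m u)) x).
  pose G x := g (aff 1%:M u x).
  have mg : measurable_fun setT g.
    apply: measurable_funM => //.
    apply: measurableT_comp (measurable_aff _ _).
    exact: measurable_stdnormal_density.
  have mG : measurable_fun setT G by exact: measurableT_comp mg (measurable_aff _ _).
  have g0 x : 0 <= g x by rewrite mulr_ge0// ltW// stdnormal_density_gt0.
  have G0 x : 0 <= G x by exact: g0.
  have mfa : measurable_fun setT (fun x => f (aff M u x)).
    exact: measurableT_comp mf (measurable_aff _ _).
  rewrite (ge0_integral_gaussian_lebesgue (fun x => f (aff M u x)))//.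
  transitivity (\int[mu]_x (G x)%:E)%E.
    rewrite [RHS]ge0_integral_image; last 2 first.
    - exact/measurable_EFinP.
    - by move=> x; rewrite lee_fin.
    apply: eq_integral => x _; congr EFin; rewrite /G /g !aff_comp.
    congr (f _ * phi _); apply: colv_inj; rewrite !colv_aff.
      by rewrite !mul1mx add0r.
    by rewrite !mul1mx add0r mulVmx// mul1mx subrr addr0.
  transitivity (k%:E * \int[nu]_x (G x)%:E)%E.
    rewrite -(ge0_integral_mscale nu measurableT (NngNum k0))//=; last 2 first.
    - exact/measurable_EFinP.
    - by move=> x _; rewrite lee_fin.
    by apply: eq_measure_integral => A mA _; exact: muE.
  have mgE : measurable_fun setT (fun x => (g x)%:E) by exact/measurable_EFinP.
  have gE0 x : (0 <= (g x)%:E)%E by rewrite lee_fin.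
  rewrite (integral_shift nu u (fun x => (g x)%:E))// -ge0_integralZl//.
  by apply: eq_integral => x _; rewrite -EFinM /g mulrCA.
exists k => //; rewrite lt_neqAle k0 andbT; apply/eqP => k00.
(* Tested on the constant function 1, a zero [k] would give [P] total mass 0. *)
have := main 0 (fun=> 1) (measurable_cst _) (fun=> ler01).
rewrite -k00; under [RHS]eq_integral do rewrite mul0r mulr0.
rewrite integral0; have := expectation_cst P 1; rewrite unlock => -> /eqP.
by rewrite eqe oner_eq0.
Qed.

End gaussian_density.

(** * White noise and its samples *)

Section inner_product.
Context {R : realType} (T0 : R).
Local Notation mu := (@lebesgue_measure R).
Local Notation D := (`[0, T0]%classic : set R).
Implicit Types f g h : R -> R.

Let mD : measurable (D : set (measurableTypeR R)). Proof. exact: measurable_itv. Qed.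

Lemma L2fun_integrableM f g : L2fun T0 f -> L2fun T0 g ->
  mu.-integrable D (fun t => (f t * g t)%:E).
Proof.
move=> [mf f2] [mg g2].
apply: (le_integrable mD _ _ (integrableD mD f2 g2)).
  by apply/measurable_EFinP; exact: measurable_funM.
move=> t _ /=; rewrite lee_fin.
have h0 : 0 <= f t ^+ 2 + g t ^+ 2 by rewrite addr_ge0// sqr_ge0.
rewrite [leRHS]ger0_norm// ler_norml; apply/andP; split.
  have := sqr_ge0 (f t + g t); rewrite sqrrD; move: (sqr_ge0 (f t)) (sqr_ge0 (g t)); lra.
have := sqr_ge0 (f t - g t); rewrite sqrrB; move: (sqr_ge0 (f t)) (sqr_ge0 (g t)); lra.
Qed.

Lemma L2funD f g : L2fun T0 f -> L2fun T0 g -> L2fun T0 (fun t => f t + g t).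
Proof.
move=> hf hg; have fg := L2fun_integrableM _ _ hf hg.
have ff := hf.2; have gg := hg.2; split; first by apply: measurable_funD; [case: hf|case: hg].
apply: eq_integrable (integrableD mD ff (integrableD mD gg (integrableD mD fg fg))) => //.
by move=> t _ /=; rewrite -!EFinD; congr EFin; ring.
Qed.

Lemma L2funZ a f : L2fun T0 f -> L2fun T0 (fun t => a * f t).
Proof.
move=> [mf f2]; split; first exact: measurable_funM.
apply: eq_integrable (integrableZl mD (a ^+ 2) f2) => //.
by move=> t _ /=; rewrite -EFinM exprMn.
Qed.

Lemma L2fun0 : L2fun T0 (fun=> 0).
Proof.
split; first exact: measurable_cst.
rewrite (_ : (fun _ : R => _) = cst 0%E); first exact: integrable0.
by apply/funext => t; rewrite expr0n.
Qed.

Lemma L2funB f g : L2fun T0 f -> L2fun T0 g -> L2fun T0 (fun t => f t - g t).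
Proof.
move=> hf /(L2funZ (-1)) hg; have := L2funD _ _ hf hg.
by under eq_fun do rewrite mulN1r.
Qed.

Lemma L2fun_sum (I : Type) (s : seq I) (a : I -> R) (f : I -> R -> R) :
  (forall i, L2fun T0 (f i)) -> L2fun T0 (fun t => \sum_(i <- s) a i * f i t).
Proof.
move=> hf; elim: s => [|i s ih].
  by under eq_fun do rewrite big_nil; exact: L2fun0.
under eq_fun do rewrite big_cons.
exact: L2funD (L2funZ _ _ (hf i)) ih.
Qed.

Lemma ipC f g : ip T0 f g = ip T0 g f.
Proof. by rewrite /ip; under eq_Rintegral do rewrite mulrC. Qed.

Lemma ipDl f g h : L2fun T0 f -> L2fun T0 g -> L2fun T0 h ->
  ip T0 (fun t => f t + g t) h = ip T0 f h + ip T0 g h.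
Proof.
move=> hf hg hh; rewrite /ip; under eq_Rintegral do rewrite mulrDl.
by rewrite RintegralD//; exact: L2fun_integrableM.
Qed.

Lemma ipZl a f h : L2fun T0 f -> L2fun T0 h ->
  ip T0 (fun t => a * f t) h = a * ip T0 f h.
Proof.
move=> hf hh; rewrite /ip; under eq_Rintegral do rewrite -mulrA.
by rewrite RintegralZl//; exact: L2fun_integrableM.
Qed.

Lemma ipBl f g h : L2fun T0 f -> L2fun T0 g -> L2fun T0 h ->
  ip T0 (fun t => f t - g t) h = ip T0 f h - ip T0 g h.
Proof.
move=> hf hg hh; rewrite -[- ip _ g _]mulN1r -ipZl// -ipDl//; last exact: L2funZ.
by under [in RHS]eq_fun do rewrite mulN1r.
Qed.

Lemma ip0l f : ip T0 (fun=> 0) f = 0.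
Proof.
rewrite /ip; under eq_Rintegral do rewrite mul0r.
by rewrite /Rintegral integral0.
Qed.

Lemma ip_suml (I : Type) (s : seq I) (a : I -> R) (f : I -> R -> R) h :
  (forall i, L2fun T0 (f i)) -> L2fun T0 h ->
  ip T0 (fun t => \sum_(i <- s) a i * f i t) h = \sum_(i <- s) a i * ip T0 (f i) h.
Proof.
move=> hf hh; elim: s => [|i s ih].
  by under eq_fun do rewrite big_nil; rewrite big_nil ip0l.
under eq_fun do rewrite big_cons.
by rewrite ipDl ?ipZl ?ih ?big_cons//; [exact: L2funZ|exact: L2fun_sum].
Qed.

Lemma ip_sumr (I : Type) (s : seq I) (a : I -> R) (f : I -> R -> R) h :
  (forall i, L2fun T0 (f i)) -> L2fun T0 h ->
  ip T0 h (fun t => \sum_(i <- s) a i * f i t) = \sum_(i <- s) a i * ip T0 h (f i).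
Proof.
move=> hf hh; rewrite ipC ip_suml//.
by apply: eq_bigr => i _; rewrite ipC.
Qed.

Lemma ip_ge0 f : 0 <= ip T0 f f.
Proof. by rewrite /ip Rintegral_ge0// => t _; rewrite -expr2 sqr_ge0. Qed.

Lemma L2norm_sqr f : L2norm T0 f ^+ 2 = ip T0 f f.
Proof. by rewrite /L2norm sqr_sqrtr// ip_ge0. Qed.

Lemma ip_norm_le f g : L2fun T0 f -> L2fun T0 g ->
  `|ip T0 f g| <= L2norm T0 f * L2norm T0 g.
Proof.
move=> hf hg.
have q a b : 0 <= a ^+ 2 * ip T0 f f + 2 * (a * b) * ip T0 f g + b ^+ 2 * ip T0 g g.
  have ha := L2funZ a _ hf; have hb := L2funZ b _ hg; have hab := L2funD _ _ ha hb.
  have := ip_ge0 (fun t => a * f t + b * g t).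
  rewrite ipDl// !ipZl// ![ip T0 _ (fun t => _ + _)]ipC !ipDl// !ipZl//.
  by rewrite (ipC g f) => /le_trans; apply; rewrite le_eqVlt; apply/orP; left; apply/eqP; ring.
have A0 := ip_ge0 f; have B0 := ip_ge0 g.
rewrite /L2norm -sqrtrM// -sqrtr_sqr ler_wsqrtr//.
have [f0|fn0] := eqVneq (ip T0 f f) 0.
  have [->|gn0] := eqVneq (ip T0 f g) 0; first by rewrite expr0n mulr_ge0.
  (* With [ip T0 f f = 0] the form is affine in [a]; this witness gives it the value -1, a
     contradiction. *)
  have := q (- (ip T0 g g + 1) / (2 * ip T0 f g)) 1; rewrite f0 mulr0 add0r !mulr1 expr1n mul1r.
  have -> : 2 * (- (ip T0 g g + 1) / (2 * ip T0 f g)) * ip T0 f g = - (ip T0 g g + 1).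
    by field.
  by lra.
have fp : 0 < ip T0 f f by rewrite lt_neqAle eq_sym fn0.
have := q (- ip T0 f g) (ip T0 f f).
set x := ip T0 f g; set A := ip T0 f f; set B := ip T0 g g => h.
have : 0 <= A * (A * B - x ^+ 2).
  by apply: le_trans h _; rewrite le_eqVlt; apply/orP; left; apply/eqP; ring.
by rewrite pmulr_rge0// subr_ge0.
Qed.

End inner_product.

Section sampled_noise.
Context {R : realType} (T0 : R) (d : measure_display) (T : measurableType d).
Variables (P : probability T R) (W : (R -> R) -> T -> R) (sig2 : R).
Hypothesis hW : white_noise P T0 sig2 W.

Lemma white_noise_cov f g : L2fun T0 f -> L2fun T0 g ->
  has_mean _ _ P (fun w => W f w * W g w) (sig2 * ip T0 f g).
Proof.
by move=> hf hg; have [_ [i]] := hW f g hf hg; rewrite unlock.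
Qed.

(** Joint Gaussianity provides some variance [v]; comparing the second moment computed from the
    generating function with the covariance identifies it. *)
Lemma white_noise_gaussian f : L2fun T0 f ->
  is_gaussian P (W f) 0 (sig2 * ip T0 f f).
Proof.
move=> hf; have [jg _] := hW f f hf hf.
have [v] := jg 1 0.
rewrite (_ : (fun w => _) = W f); last by apply/funext => w; rewrite mul1r mul0r addr0.
move=> hg; suff <- : v = sig2 * ip T0 f f by [].
have [_ e1] := mgf_second_moment _ _ P (W f) v hg.1 (fun a => gaussian_mgf _ _ P _ _ a hg).
have [_] := white_noise_cov _ _ hf hf.
by under eq_integral do rewrite -expr2; rewrite e1 => -[].
Qed.

(** Expanding the square of the difference and inserting the covariances gives [E Y^2 = 0], because
    the inner product is bilinear. *)
Lemma white_noise_linear (n : nat) (a : 'I_n -> R) (s : 'I_n -> R -> R) :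
  (forall i, L2fun T0 (s i)) ->
  {ae P, forall w, W (fun t => \sum_i a i * s i t) w = \sum_i a i * W (s i) w}.
Proof.
move=> hs; set F := fun t => \sum_i a i * s i t.
have hF : L2fun T0 F by exact: L2fun_sum.
pose Y w := W F w - \sum_i a i * W (s i) w.
have mW f : L2fun T0 f -> measurable_fun setT (W f).
  by move=> /white_noise_gaussian[].
have mY : measurable_fun setT Y.
  apply: measurable_funB; first exact: mW.
  by apply: measurable_sum => i; apply: measurable_funM => //; exact: mW.
have Y2 : has_mean _ _ P (fun w => Y w ^+ 2) 0.
  have h1 := white_noise_cov _ _ hF hF.
  have h2 : has_mean _ _ P (fun w => \sum_i (2 * a i) * (W F w * W (s i) w))
      (\sum_i (2 * a i) * (sig2 * ip T0 F (s i))).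
    by apply: has_mean_sum => i; apply: has_meanZ; exact: white_noise_cov.
  have h3 : has_mean _ _ P (fun w => \sum_i \sum_j (a i * a j) * (W (s i) w * W (s j) w))
      (\sum_i \sum_j (a i * a j) * (sig2 * ip T0 (s i) (s j))).
    apply: has_mean_sum => i; apply: has_mean_sum => j; apply: has_meanZ.
    exact: white_noise_cov.
  have := has_meanD _ _ _ _ _ _ _ (has_meanB _ _ _ _ _ _ _ h1 h2) h3.
  have -> : sig2 * ip T0 F F - \sum_i (2 * a i) * (sig2 * ip T0 F (s i)) +
      \sum_i \sum_j (a i * a j) * (sig2 * ip T0 (s i) (s j)) = 0.
    have e1 : \sum_i (2 * a i) * (sig2 * ip T0 F (s i)) = 2 * (sig2 * ip T0 F F).
      rewrite {3}/F ip_sumr// !mulr_sumr; apply: eq_bigr => i _; ring.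
    have e2 : \sum_i \sum_j (a i * a j) * (sig2 * ip T0 (s i) (s j)) = sig2 * ip T0 F F.
      rewrite {1}/F ip_suml// mulr_sumr; apply: eq_bigr => i _.
      rewrite /F ip_sumr// !mulr_sumr; apply: eq_bigr => j _; ring.
    rewrite e1 e2; ring.
  congr has_mean; apply/funext => w; rewrite /Y sqrrB; congr (_ - _ + _).
    by rewrite mulr_sumr -sumrMnl; apply: eq_bigr => i _; rewrite mulr2n; ring.
  rewrite expr2 mulr_suml; apply: eq_bigr => i _; rewrite mulr_sumr.
  by apply: eq_bigr => j _; ring.
have mY2 : measurable_fun setT (fun w => (Y w ^+ 2)%:E) by exact: measurable_int Y2.1.
have : (\int[P]_w `|(Y w ^+ 2)%:E| = 0)%E.
  by under eq_integral do rewrite gee0_abs ?lee_fin ?sqr_ge0//; exact: Y2.2.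
move/(ae_eq_integral_abs P measurableT mY2); apply: filterS => w /(_ I).
by rewrite /Y /= => -[] /eqP; rewrite sqrf_eq0 subr_eq0 => /eqP.
Qed.

Variables (N : nat) (s : 'I_N -> R -> R) (v : 'I_N -> T -> R) (sigd2 : R).
Hypothesis hs : forall n, L2fun T0 (s n).
Hypothesis hv : forall n, is_gaussian P (v n) 0 sigd2.
Hypothesis iv : mutually_indep P v.
Hypothesis ivW : indep_of_noise P T0 v W.

(** By almost sure linearity, the exponent is [W F] plus a combination of the [v i]. So [indep_mgf]
    is applied to [N.+1] independent variables, index 0 being [W F] and the others the discrete
    noise. *)
Lemma sampled_noise_mgf (a : 'I_N -> R) :
  (\int[P]_w (expR (\sum_i a i * (W (s i) w + v i w)))%:E =
   (expR ((sig2 * ip T0 (fun t => \sum_i a i * s i t) (fun t => \sum_i a i * s i t) +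
     sigd2 * \sum_i a i ^+ 2) / 2))%:E)%E.
Proof.
set F := fun t => \sum_i a i * s i t.
have hF : L2fun T0 F by exact: L2fun_sum.
have gF := white_noise_gaussian _ hF.
pose Y (i : 'I_N.+1) := if unlift ord0 i is Some j then v j else W F.
pose b (i : 'I_N.+1) := if unlift ord0 i is Some j then a j else 1.
pose m (i : 'I_N.+1) := if unlift ord0 i is Some j then expR (sigd2 * a j ^+ 2 / 2)
  else expR (sig2 * ip T0 F F / 2).
have mY i : measurable_fun setT (Y i).
  by rewrite /Y; case: unliftP => [j|] _; [case: (hv j)|case: gF].
have mWs i : measurable_fun setT (W (s i)) by case: (white_noise_gaussian _ (hs i)).
have mv i : measurable_fun setT (v i) by case: (hv i).
have Y0 : Y ord0 = W F by rewrite /Y unlift_none.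
have YS j : Y (lift ord0 j) = v j by rewrite /Y liftK.
have := @indep_mgf R d T P N.+1 Y b m mY.
have -> : \prod_i m i = expR ((sig2 * ip T0 F F + sigd2 * \sum_i a i ^+ 2) / 2).
  rewrite big_ord_recl /m unlift_none.
  under eq_bigr do rewrite liftK.
  by rewrite -expR_sum -expRD mulrDl mulr_sumr mulr_suml.
have -> : (\int[P]_w (\prod_i expR (b i * Y i w))%:E =
    \int[P]_w (expR (\sum_i a i * (W (s i) w + v i w)))%:E)%E.
  apply: ae_eq_integral => //.
  - apply/measurable_EFinP; apply: measurable_prod => i _.
    exact: measurable_expRM.
  - apply/measurable_EFinP; apply: measurableT_comp => //.
    apply: measurable_sum => i; apply: measurable_funM => //.
    exact: measurable_funD.
  have := white_noise_linear N a s hs; apply: filterS => w hw _; congr EFin.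
  rewrite big_ord_recl /b unlift_none Y0 mul1r hw.
  rewrite [X in _ * X](eq_bigr (fun i => expR (a i * v i w))); last first.
    by move=> i _; rewrite YS liftK.
  rewrite -expR_sum -expRD -big_split /=; congr expR.
  by apply: eq_bigr => i _; rewrite mulrDr.
apply.
- move=> B mB.
  have := ivW (fun n => B (lift ord0 n)) [:: (F, B ord0)] (fun n => mB _).
  set E1 := \bigcap_(n in _) _; set E2 := \bigcap_(i in _) _ => hE.
  have E2E : E2 = W F @^-1` B ord0.
    apply/seteqP; split => w; first by move=> /(_ 0%N); exact.
    by move=> hw [|//] _.
  have -> : \bigcap_(i in [set: 'I_N.+1]) (Y i @^-1` B i) = E1 `&` E2.
    rewrite E2E; apply/seteqP; split => w.
      move=> hw; split; last by have := hw ord0 I; rewrite Y0.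
      by move=> j _; have := hw (lift ord0 j) I; rewrite YS.
    move=> [h1 h2] i _; rewrite /Y.
    case: unliftP => [j|] ->; [exact: h1|exact: h2].
  rewrite hE; last by move=> p; rewrite inE => /eqP ->; split => //; exact: mB.
  rewrite big_ord_recl Y0 muleC E2E; congr (_ * _)%E.
  rewrite /E1 iv; last by move=> n; exact: mB.
  by apply: eq_bigr => j _; rewrite YS.
- move=> i; rewrite /b /Y /m; case: unliftP => [j|] _.
    by rewrite (gaussian_mgf _ _ P _ _ _ (hv j)).
  by rewrite (gaussian_mgf _ _ P _ _ _ gF) expr1n mulr1.
Qed.

End sampled_noise.

(** * Likelihood ratios and Fisher information *)

Section gaussian_model.
Context {R : realType} (d : measure_display) (T : measurableType d).
Variables (P : probability T R) (n : nat) (Z : T -> n.-tuple R).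
Hypothesis mZ : measurable_fun setT Z.
Hypothesis mgfZ : forall a : 'I_n -> R,
  (\int[P]_w (expR (\sum_i a i * tnth (Z w) i))%:E =
   (expR (\sum_i a i ^+ 2 / 2))%:E)%E.

Let mlin (a : 'I_n -> R) : measurable_fun setT (fun w => \sum_i a i * tnth (Z w) i).
Proof.
apply: measurable_sum => i; apply: measurable_funM => //.
exact: (measurableT_comp (measurable_tnth i) mZ).
Qed.

Lemma gaussian_second_moment (a : 'I_n -> R) :
  has_mean _ _ P (fun w => (\sum_i a i * tnth (Z w) i) ^+ 2) (\sum_i a i ^+ 2).
Proof.
apply: mgf_second_moment => // t.
under eq_integral.
  move=> w _; rewrite mulr_sumr; under eq_bigr do rewrite mulrA.
  over.
rewrite (mgfZ (fun i => t * a i)); congr (expR _)%:E.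
by rewrite mulrAC mulr_suml mulr_suml; apply: eq_bigr => i _; rewrite exprMn; ring.
Qed.

(** Polarisation of [gaussian_second_moment]. *)
Lemma gaussian_covariance (a b : 'I_n -> R) :
  has_mean _ _ P (fun w => (\sum_i a i * tnth (Z w) i) * (\sum_i b i * tnth (Z w) i))
    (\sum_i a i * b i).
Proof.
have := has_meanZ _ _ _ 4^-1 _ _ (has_meanB _ _ _ _ _ _ _
  (gaussian_second_moment (fun i => a i + b i))
  (gaussian_second_moment (fun i => a i - b i))).
congr has_mean.
  apply/funext => w.
  under [X in X ^+ 2 - _]eq_bigr do rewrite mulrDl.
  under [X in _ - X ^+ 2]eq_bigr do rewrite mulrBl.
  by rewrite big_split sumrB /=; field.
rewrite -sumrB mulr_sumr; apply: eq_bigr => i _; by field.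
Qed.

(** The density of the law of [Z + u] with respect to the law of [Z] (Cameron-Martin), evaluated at
    [Z w]. *)
Definition lratio (u : 'cV[R]_n) (w : T) : R :=
  expR (\sum_i u i ord0 * tnth (Z w) i - \sum_i u i ord0 ^+ 2 / 2).

Lemma measurable_lratio u : measurable_fun setT (lratio u).
Proof.
by apply: measurableT_comp => //; apply: measurable_funB.
Qed.

Lemma lratio_mean u : has_mean _ _ P (lratio u) 1.
Proof.
apply: ge0_has_mean; first exact: measurable_lratio.
  by move=> w; exact: expR_ge0.
rewrite /lratio; under eq_integral do rewrite expRB EFinM.
rewrite ge0_integralZr//; last first.
  by apply/measurable_EFinP; apply: measurableT_comp => //; exact: mlin.
by rewrite (mgfZ (fun i => u i ord0)) -EFinM divff// gt_eqF// expR_gt0.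
Qed.

(** The product of the two ratios is [exp (u.v)] times the ratio of [u + v], whose mean is 1. *)
Lemma lratio_covariance u v :
  has_mean _ _ P (fun w => lratio u w * lratio v w) (expR (\sum_i u i ord0 * v i ord0)).
Proof.
have := has_meanZ _ _ _ (expR (\sum_i u i ord0 * v i ord0)) _ _ (lratio_mean (u + v)).
rewrite mulr1; congr has_mean; apply/funext => w; rewrite /lratio -!expRD; congr expR.
under [X in _ + (X - _)]eq_bigr do rewrite mxE mulrDl.
under [X in _ + (_ - X)]eq_bigr do rewrite mxE.
rewrite big_split /=.
have -> : \sum_i (u i ord0 + v i ord0) ^+ 2 / 2 = \sum_i u i ord0 ^+ 2 / 2 +
    \sum_i v i ord0 ^+ 2 / 2 + \sum_i u i ord0 * v i ord0.
  by rewrite -!big_split /=; apply: eq_bigr => i _; field.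
ring.
Qed.

Lemma stdnormal_densityE (x : n.-tuple R) : stdnormal_density n x =
  normal_peak 1 ^+ n * expR (- \sum_i tnth x i ^+ 2 / 2).
Proof.
rewrite /stdnormal_density.
under eq_bigr do rewrite normal_pdfE ?oner_neq0// /normal_fun subr0 expr1n.
rewrite big_split /= prodr_const card_ord -expR_sum; congr (_ * expR _).
by rewrite -sumrN; apply: eq_bigr => i _; rewrite mulNr.
Qed.

(** [L x * phi x] is [phi] at [x - u], so the identity is translation invariance of
    [gaussian_lebesgue]. *)
Lemma ge0_gaussian_shift (u : 'cV[R]_n) (g : n.-tuple R -> R) :
  measurable_fun setT g -> (forall x, 0 <= g x) ->
  (\int[P]_w (g (aff 1%:M u (Z w)))%:E = \int[P]_w (g (Z w) * lratio u w)%:E)%E.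
Proof.
move=> mg g0; pose nu := gaussian_lebesgue _ _ P n Z mZ.
pose L (x : n.-tuple R) : R := expR (\sum_i u i ord0 * tnth x i - \sum_i u i ord0 ^+ 2 / 2).
have mL : measurable_fun setT L.
  apply: measurableT_comp => //; apply: measurable_funB => //.
  apply: measurable_sum => i; apply: measurable_funM => //; exact: measurable_tnth.
pose phi (x : n.-tuple R) := stdnormal_density n x.
have mphi := @measurable_stdnormal_density R n.
have phi0 x : 0 <= phi x by rewrite ltW// stdnormal_density_gt0.
have inu : shift_invariant nu.
  by apply: box_lebesgue_shift_invariant; exact: gaussian_lebesgueP.
rewrite (ge0_integral_gaussian_lebesgue _ _ P _ _ mZ (fun x => g (aff 1%:M u x)))//; last first.
  exact: measurableT_comp mg (measurable_aff _ _).
rewrite (ge0_integral_gaussian_lebesgue _ _ P _ _ mZ (fun x => g x * L x)); last 2 first.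
- exact: measurable_funM.
- by move=> x; rewrite mulr_ge0 ?expR_ge0.
have mF : measurable_fun setT (fun x => (g x * L x * phi x)%:E).
  by apply/measurable_EFinP; apply: measurable_funM => //; exact: measurable_funM.
have F0 x : (0 <= (g x * L x * phi x)%:E)%E.
  by rewrite lee_fin mulr_ge0// mulr_ge0 ?expR_ge0.
apply: etrans (integral_shift nu u _ inu mF F0).
apply: eq_integral => x _; rewrite -mulrA; congr (_ * _)%:E.
rewrite /phi !stdnormal_densityE mulrCA; congr (_ * _); rewrite /L -expRD; congr expR.
under [X in _ = X - _ + _]eq_bigr do rewrite tnth_mktuple mul1mx !mxE.
under [X in _ = _ - X]eq_bigr do rewrite tnth_mktuple mul1mx !mxE.
rewrite -!sumrN -!big_split /=; apply: eq_bigr => i _; by field.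
Qed.

Lemma gaussian_shift (u : 'cV[R]_n) (g : n.-tuple R -> R) r :
  measurable_fun setT g -> has_mean _ _ P (fun w => g (aff 1%:M u (Z w))) r ->
  has_mean _ _ P (fun w => g (Z w) * lratio u w) r.
Proof.
move=> mg hg.
have part (f : n.-tuple R -> R) : measurable_fun setT f -> (forall x, 0 <= f x) ->
    (forall x, f x <= `|g x|) ->
    exists2 s, has_mean _ _ P (fun w => f (aff 1%:M u (Z w))) s &
      has_mean _ _ P (fun w => f (Z w) * lratio u w) s.
  move=> mf f0 fg.
  have mfa : measurable_fun setT (fun w => f (aff 1%:M u (Z w))).
    apply: measurableT_comp mf _; exact: measurableT_comp (measurable_aff _ _) mZ.
  have fi : P.-integrable setT (fun w => (f (aff 1%:M u (Z w)))%:E).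
    apply: (le_integrable measurableT _ _ hg.1); first exact/measurable_EFinP.
    by move=> w _ /=; rewrite lee_fin ger0_norm.
  have e : (\int[P]_w (f (aff 1%:M u (Z w)))%:E =
      (fine (\int[P]_w (f (aff 1%:M u (Z w)))%:E))%:E)%E.
    by rewrite fineK//; exact: integrable_fin_num.
  eexists; first by split; [exact: fi|exact: e].
  apply: ge0_has_mean.
  - apply: measurable_funM; last exact: measurable_lratio.
    exact: measurableT_comp mf mZ.
  - by move=> w; rewrite mulr_ge0 ?expR_ge0.
  - by rewrite -ge0_gaussian_shift.
pose gp x := Num.max (g x) 0; pose gm x := Num.max (- g x) 0.
have gE x : g x = gp x - gm x.
  by rewrite /gp /gm; case: (leP (g x) 0); case: (leP (- g x) 0); lra.
have [p hp1 hp2] : exists2 s, has_mean _ _ P (fun w => gp (aff 1%:M u (Z w))) s &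
    has_mean _ _ P (fun w => gp (Z w) * lratio u w) s.
  apply: part; first exact: measurable_maxr.
    by move=> x; rewrite /gp le_max lexx orbT.
  by move=> x; rewrite /gp ge_max ler_norm normr_ge0.
have [q hq1 hq2] : exists2 s, has_mean _ _ P (fun w => gm (aff 1%:M u (Z w))) s &
    has_mean _ _ P (fun w => gm (Z w) * lratio u w) s.
  apply: part; first by apply: measurable_maxr => //; exact: measurableT_comp.
    by move=> x; rewrite /gm le_max lexx orbT.
  by move=> x; rewrite /gm ge_max normr_ge0 -normrN ler_norm.
have -> : r = p - q.
  have := has_meanB _ _ _ _ _ _ _ hp1 hq1.
  rewrite (_ : (fun w => _) = fun w => g (aff 1%:M u (Z w))); last first.
    by apply/funext => w; rewrite -gE.
  by move=> [_]; rewrite hg.2 => -[].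
have := has_meanB _ _ _ _ _ _ _ hp2 hq2; congr has_mean.
by apply/funext => w; rewrite -mulrBl -gE.
Qed.

End gaussian_model.

(** * Differentiation in the parameter *)

Section directional_derivative.
Context {R : realType} {K : nat} (th v : 'rV[R]_K).

Definition has_deriv (f : 'rV[R]_K -> R) (l : R) : Prop :=
  differentiable f th /\ 'D_v f th = l.

Lemma has_deriv_cst c : has_deriv (fun=> c) 0.
Proof. by split; [exact: differentiable_cst|exact: derive_cst]. Qed.

Lemma has_derivD f g l m : has_deriv f l -> has_deriv g m ->
  has_deriv (fun x => f x + g x) (l + m).
Proof.
move=> [df fl] [dg gm]; split; first exact: differentiableD.
by rewrite -fl -gm; apply: deriveD; exact: diff_derivable.
Qed.

Lemma has_derivM f g l m : has_deriv f l -> has_deriv g m ->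
  has_deriv (fun x => f x * g x) (f th * m + g th * l).
Proof.
move=> [df fl] [dg gm]; split; first exact: differentiableM.
by rewrite -fl -gm; apply: deriveM; exact: diff_derivable.
Qed.

Lemma has_derivZ c f l : has_deriv f l -> has_deriv (fun x => c * f x) (c * l).
Proof.
move=> hf; have := has_derivM _ _ _ _ (has_deriv_cst c) hf.
by rewrite mulr0 addr0.
Qed.

Lemma has_deriv_sum n (f : 'I_n -> 'rV[R]_K -> R) (l : 'I_n -> R) :
  (forall i, has_deriv (f i) (l i)) ->
  has_deriv (fun x => \sum_i f i x) (\sum_i l i).
Proof.
move=> h; rewrite (_ : (fun x => _) = \sum_i f i); last first.
  by apply/funext => x; rewrite fct_sumE.
split; first by apply: differentiable_sum => i; case: (h i).
rewrite derive_sum; first by apply: eq_bigr => i _; case: (h i).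
by move=> i; apply: diff_derivable; case: (h i).
Qed.

Lemma has_deriv_expR f l : has_deriv f l ->
  has_deriv (fun x => expR (f x)) (expR (f th) * l).
Proof.
move=> [df fl].
have de : differentiable (expR : R -> R) (f th).
  by apply/derivable1_diffP; exact: derivable_expR.
have dc : differentiable (expR \o f) th by exact: differentiable_comp.
split; first exact: dc.
rewrite -[X in 'D_v X th]/(expR \o f) deriveE// diff_comp//= diff1E//.
have -> : expR^`()%classic (f th) = expR (f th) :> R.
  by rewrite derive1E; exact: (congr1 (fun g => g (f th)) (@derive_expR R)).
by rewrite -deriveE// fl mulrC.
Qed.

End directional_derivative.

Section linear_form.
Context {R : realType} {K : nat}.

Definition lform (a : 'I_K -> R) (x : 'rV[R]_K) : R := \sum_k x ord0 k * a k.

Lemma lform_is_linear a : linear (lform a : 'rV[R]_K -> R).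
Proof.
move=> c x y; rewrite /lform /= scaler_sumr -big_split /=.
by apply: eq_bigr => k _; rewrite !mxE mulrDl -mulrA.
Qed.

HB.instance Definition _ a :=
  GRing.isLinear.Build R 'rV[R]_K R _ (lform a) (lform_is_linear a).

Lemma lform_evec a k : lform a (evec k) = a k.
Proof.
rewrite /lform (bigD1 k)//= mxE !eqxx mul1r big1 ?addr0// => j jk.
by rewrite mxE (negbTE jk) andbF mul0r.
Qed.

Lemma lform_differentiable a x : differentiable (lform a : 'rV[R]_K -> R) x.
Proof.
rewrite (_ : lform a = \sum_k (fun x : 'rV[R]_K => x ord0 k * a k)); last first.
  by apply/funext => y; rewrite /lform fct_sumE.
apply: differentiable_sum => k.
apply: (@differentiableM _ _ (fun x : 'rV[R]_K => x ord0 k) (cst (a k))) => //.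
exact: differentiable_coord.
Qed.

Lemma lform_continuous a : continuous (lform a : 'rV[R]_K -> R).
Proof. by move=> x; apply: differentiable_continuous; exact: lform_differentiable. Qed.

(** Passes from an epsilon estimate, the form in which [frechet_L2] is stated, to the differential:
    uniqueness of the first-order part identifies it with [lform a]. *)
Lemma diff_of_expansion (f : 'rV[R]_K -> R) (th : 'rV[R]_K) (a : 'I_K -> R) :
  (forall eps, 0 < eps -> exists2 r, 0 < r & forall dl : 'rV[R]_K, `|dl| < r ->
     `|f (th + dl) - f th - lform a dl| <= eps * `|dl|) ->
  forall v, has_deriv th v f (lform a v).
Proof.
move=> h.
pose z : 'rV[R]_K := 0.
have ex : f \o shift th = cst (f th) + lform a +o_z id.
  apply/eqaddoP => eps eps0; have [r r0 hr] := h _ eps0.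
  have := @nbhs0_lt R 'rV[R]_K r r0; apply: filterS => dl.
  move=> /hr; rewrite /= !fctE; congr (`|_| <= _).
  by rewrite /= opprD addrA [dl + th]addrC.
have dE := diff_unique (lform_continuous a) ex.
have df : differentiable f th.
  by apply/diff_locallyP; rewrite dE; split => //; exact: lform_continuous.
by move=> v; split => //; rewrite deriveE// dE.
Qed.

End linear_form.

(** Displays the information as a Gram matrix [B^T B], which gives both its entries as covariances
    of linear scores and its definiteness. *)
Lemma whitened_gram {R : comUnitRingType} n K (M : 'M[R]_n) (S : 'M[R]_(n, K)) :
  M \in unitmx ->
  S^T *m invmx (M *m M^T) *m S = (invmx M *m S)^T *m (invmx M *m S).
Proof.
move=> Mu; rewrite trmx_mul trmx_inv !mulmxA; congr (_ *m _).
rewrite -!mulmxA; congr (_ *m _).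
have MTu : M^T \in unitmx by rewrite unitmx_tr.
have MMu : M *m M^T \in unitmx by rewrite unitmx_mul Mu.
rewrite -[RHS]mulmx1 -(mulmxV MMu) !mulmxA.
by rewrite -[invmx M^T *m _ *m M]mulmxA mulVmx// mulmx1 mulVmx// mul1mx.
Qed.

Section fisher_gaussian_model.
Context {R : realType} (d : measure_display) (T : measurableType d).
Variables (P : probability T R) (n K : nat) (Z : T -> n.-tuple R).
Hypothesis mZ : measurable_fun setT Z.
Hypothesis mgfZ : forall a : 'I_n -> R,
  (\int[P]_w (expR (\sum_i a i * tnth (Z w) i))%:E =
   (expR (\sum_i a i ^+ 2 / 2))%:E)%E.
Variables (M : 'M[R]_n) (Mu : M \in unitmx).
Variables (m : 'rV[R]_K -> 'cV[R]_n) (th : 'rV[R]_K) (SD : 'M[R]_(n, K)).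
Hypothesis dm : forall i v, has_deriv th v (fun t => m t i ord0) (lform (SD i) v).

Lemma gaussian_model_fisher (Theta : set 'rV[R]_K) :
  fisher_info P Theta (fun t w => aff M (m t) (Z w)) th
    (SD^T *m invmx (M *m M^T) *m SD).
Proof.
pose nu := gaussian_lebesgue _ _ P n Z mZ.
exists nu; split; first by apply: box_lebesgue_closed; exact: gaussian_lebesgueP.
have [k k0 hk] := gaussian_affine_density _ _ P n Z mZ mgfZ M Mu.
pose zeta t x := aff (invmx M) (- (invmx M *m m t)) x.
pose p t x := k * stdnormal_density n (zeta t x).
pose B := invmx M *m SD.
have p0 t x : 0 < p t x by rewrite mulr_gt0// stdnormal_density_gt0.
pose b j v := \sum_l invmx M j l * lform (SD l) v.
(* The log-density is a constant minus half the squared norm of [zeta t x], and coordinate [j] of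
   [zeta] has derivative [- b j v]. *)
have dp v x : has_deriv th v (fun t => p t x)
    (p th x * \sum_j b j v * tnth (zeta th x) j).
  have dz j : has_deriv th v (fun t => tnth (zeta t x) j) (- b j v).
    have := has_derivD _ _ _ _ _ _ (has_deriv_cst th v ((invmx M *m colv x) j ord0))
      (has_deriv_sum th v n _ _ (fun l => has_derivZ _ _ (- invmx M j l) _ _ (dm l v))).
    rewrite (_ : _ + _ = - b j v); last first.
      by rewrite add0r /b -sumrN; apply: eq_bigr => l _; rewrite mulNr.
    congr has_deriv; apply/funext => t; rewrite tnth_mktuple !mxE; congr (_ + _).
    by rewrite -sumrN; apply: eq_bigr => l _; rewrite mulNr.
  have de := has_deriv_expR _ _ _ _ (has_derivZ _ _ (- 2^-1) _ _
     (has_deriv_sum _ _ _ _ _ (fun j => has_derivM _ _ _ _ _ _ (dz j) (dz j)))).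
  have := has_derivZ _ _ (k * normal_peak 1 ^+ n) _ _ de.
  have e t : k * normal_peak 1 ^+ n *
      expR (- 2^-1 * \sum_j tnth (zeta t x) j * tnth (zeta t x) j) = p t x.
    rewrite /p stdnormal_densityE mulrA; congr (_ * expR _).
    by rewrite mulr_sumr -sumrN; apply: eq_bigr => j _; rewrite expr2 mulNr; field.
  rewrite (_ : (fun t => _) = p^~ x); last by apply/funext => t; exact: e.
  rewrite [X in has_deriv _ _ _ X](_ : _ =
      p th x * \sum_j b j v * tnth (zeta th x) j)//.
  rewrite -(e th) -!mulrA; congr (_ * (_ * (_ * _))).
  by rewrite mulr_sumr; apply: eq_bigr => j _; field.
exists p; split; [|split].
- move=> t _; split; [|split].
  + apply: measurable_funM => //.
    apply: measurableT_comp (measurable_aff _ _); exact: measurable_stdnormal_density.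
  + by move=> x; exact: ltW.
  + move=> A mA.
    have mI : measurable_fun setT (\1_A : n.-tuple R -> R) by exact: measurable_indic.
    have I0 x : 0 <= \1_A x :> R by rewrite indicE.
    have mc : measurable_fun setT (fun w => aff M (m t) (Z w)).
      exact: measurableT_comp (measurable_aff _ _) mZ.
    have mcA : measurable ((fun w => aff M (m t) (Z w)) @^-1` A).
      by rewrite -[X in measurable X]setTI; exact: mc.
    rewrite -[X in P X]setIT -integral_indic//.
    apply: etrans (hk (m t) _ mI I0) _.
    rewrite [RHS]integral_mkcond; apply: eq_integral => x _; rewrite patchE indicE.
    by case: ifP => _; rewrite ?mul1r ?mul0r.
- by move=> x; case: (dp 0 x).
move=> score i j.
(* On data generated under [th], [zeta th] undoes the affine map and returns [Z w]. *)
have scoreE l w : score l (aff M (m th) (Z w)) = \sum_a B a l * tnth (Z w) a.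
  rewrite /score (dp (evec l) _).2 mulrC mulKf ?gt_eqF//.
  have -> : zeta th (aff M (m th) (Z w)) = Z w by rewrite /zeta affK.
  apply: eq_bigr => a _; congr (_ * _); rewrite /b /B mxE.
  by apply: eq_bigr => q _; rewrite lform_evec.
have hJ : (SD^T *m invmx (M *m M^T) *m SD) i j = \sum_a B a i * B a j.
  rewrite whitened_gram// -/B.
  by rewrite mxE; apply: eq_bigr => a _; rewrite mxE.
have [h1 h2] := gaussian_covariance _ _ P n Z mZ mgfZ (fun a => B a i) (fun a => B a j).
rewrite hJ -h2; split.
  by apply: eq_integrable h1 => // w _; rewrite !scoreE.
by rewrite unlock; apply: eq_integral => w _; rewrite !scoreE.
Qed.

End fisher_gaussian_model.

(** * The Chapman-Robbins inequality and its limit *)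

Section lower_integral.
Context {R : realType} (d : measure_display) (T : measurableType d).
Variable P : probability T R.

(* [g] need not be measurable: the integral of a nonnegative function is the
   supremum of the integrals of the simple functions below it. *)
Lemma has_mean_le_integral (f g : T -> R) r : has_mean _ _ P f r ->
  (forall w, 0 <= g w) -> (forall w, f w <= g w) ->
  (r%:E <= \int[P]_w (g w)%:E)%E.
Proof.
move=> [fi <-] g0 fg.
have mf := measurable_int _ fi.
pose f' w : R := Num.max (f w) 0.
have f'0 w : 0 <= f' w by rewrite /f' le_max lexx orbT.
have mf' : measurable_fun setT f'.
  by apply: measurable_maxr => //; exact/measurable_EFinP.
apply: (@le_trans _ _ (\int[P]_w (f' w)%:E)%E).
  apply: le_integral => //.
    apply: (le_integrable measurableT _ _ fi); first exact/measurable_EFinP.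
    move=> w _ /=; rewrite lee_fin ger0_norm// /f' ge_max ler_norm.
    exact: normr_ge0.
  by move=> w _; rewrite lee_fin /f' le_max lexx.
rewrite !ge0_integralTE; [|by move=> w; rewrite lee_fin ..].
apply: le_ereal_sup => _ [h hh <-]; exists h => // w.
by apply: le_trans (hh w) _; rewrite lee_fin /f' ge_max fg g0.
Qed.

End lower_integral.

Section chapman_robbins.
Context {R : realType} (T0 : R) (d : measure_display) (T : measurableType d).
Variables (P : probability T R) (n K : nat) (Z : T -> n.-tuple R).
Hypothesis mZ : measurable_fun setT Z.
Hypothesis mgfZ : forall a : 'I_n -> R,
  (\int[P]_w (expR (\sum_i a i * tnth (Z w) i))%:E =
   (expR (\sum_i a i ^+ 2 / 2))%:E)%E.
Variables (M : 'M[R]_n) (Mu : M \in unitmx).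
Variables (m0 : 'cV[R]_n) (m1 : 'I_K -> 'cV[R]_n).
Variables (h0 : R -> R) (h1 dir : 'I_K -> R -> R) (xhat : n.-tuple R -> R -> R).
Hypotheses (L2h0 : L2fun T0 h0) (L2dir : forall k, L2fun T0 (dir k)).
Hypothesis L2xhat : forall y, L2fun T0 (xhat y).
Hypothesis mxhat : forall g, L2fun T0 g ->
  measurable_fun setT (fun y => ip T0 (xhat y) g).
Hypothesis unbiased0 : forall g, L2fun T0 g ->
  has_mean _ _ P (fun w => ip T0 (xhat (aff M m0 (Z w))) g) (ip T0 h0 g).
Hypothesis unbiased1 : forall l g, L2fun T0 g ->
  has_mean _ _ P (fun w => ip T0 (xhat (aff M (m1 l) (Z w))) g) (ip T0 (h1 l) g).

(** The displacement of the mean in whitened coordinates, chosen so that shifting [Z] by [u l] under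
    the mean [m0] gives the observation with mean [m1 l]. *)
Let u l := invmx M *m (m1 l - m0).
Let L l w := lratio _ _ n Z (u l) w.

(** Weighting by [L l] turns a mean at [m0] into the mean at [m1 l], where unbiasedness applies a
    second time; the constant [ip T0 h0 (dir k)] disappears because [L l - 1] has mean 0. *)
Lemma lratio_error_mean k l :
  has_mean _ _ P (fun w => (ip T0 (xhat (aff M m0 (Z w))) (dir k) - ip T0 h0 (dir k)) *
    (L l w - 1)) (ip T0 (h1 l) (dir k) - ip T0 h0 (dir k)).
Proof.
pose g x := ip T0 (xhat (aff M m0 x)) (dir k).
have mg : measurable_fun setT g.
  exact: measurableT_comp (mxhat _ (L2dir k)) (measurable_aff _ _).
have h : has_mean _ _ P (fun w => g (aff 1%:M (u l) (Z w))) (ip T0 (h1 l) (dir k)).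
  have := unbiased1 l _ (L2dir k); congr has_mean; apply/funext => w; rewrite /g.
  congr (ip T0 (xhat _)); apply: colv_inj; rewrite !colv_aff mul1mx mulmxDr.
  by rewrite /u mulKVmx// -addrA subrK.
have h2 := gaussian_shift _ _ P n Z mZ mgfZ (u l) g _ mg h.
have h3 := has_meanB _ _ _ _ _ _ _ (has_meanB _ _ _ _ _ _ _ h2 (unbiased0 _ (L2dir k)))
  (has_meanZ _ _ _ (ip T0 h0 (dir k)) _ _ (has_meanB _ _ _ _ _ _ _
    (lratio_mean _ _ P n Z mZ mgfZ (u l)) (has_mean_cst _ _ P 1))).
move: h3; rewrite subrr mulr0 subr0; congr has_mean.
by apply/funext => w; rewrite /g /L; ring.
Qed.

Lemma lratio_centered_covariance l l' :
  has_mean _ _ P (fun w => (L l w - 1) * (L l' w - 1))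
    (expR (\sum_i u l i ord0 * u l' i ord0) - 1).
Proof.
have lm q := lratio_mean _ _ P n Z mZ mgfZ (u q).
have := has_meanB _ _ _ _ _ _ _ (has_meanB _ _ _ _ _ _ _
  (lratio_covariance _ _ P n Z mZ mgfZ (u l) (u l')) (lm l))
  (has_meanB _ _ _ _ _ _ _ (lm l') (has_mean_cst _ _ P 1)).
rewrite subrr subr0; congr has_mean.
by apply/funext => w; rewrite /L; ring.
Qed.

(** The pointwise bound is [2 <V, Y> - <V, V> <= <Y, Y>] with [Y] the error. Since [V] is a
    combination of the [dir k], its left side involves the estimator only through inner products
    with fixed functions; this is why weak unbiasedness suffices. *)
Lemma chapman_robbins_bound (A : 'M[R]_K) :
  ((2 * (\sum_k \sum_l A k l * (ip T0 (h1 l) (dir k) - ip T0 h0 (dir k))) -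
    \sum_k \sum_k' \sum_l \sum_l' A k l * A k' l' * ip T0 (dir k) (dir k') *
      (expR (\sum_i u l i ord0 * u l' i ord0) - 1))%:E <=
   \int[P]_w (L2norm T0 (fun t => xhat (aff M m0 (Z w)) t - h0 t) ^+ 2)%:E)%E.
Proof.
pose e k w := ip T0 (xhat (aff M m0 (Z w))) (dir k) - ip T0 h0 (dir k).
pose q k w := \sum_l A k l * (L l w - 1).
apply: (@has_mean_le_integral R d T P (fun w =>
  2 * (\sum_k \sum_l A k l * (e k w * (L l w - 1))) -
  \sum_k \sum_k' \sum_l \sum_l' A k l * A k' l' * ip T0 (dir k) (dir k') *
    ((L l w - 1) * (L l' w - 1)))).
- apply: has_meanB; first apply: has_meanZ.
    apply: has_mean_sum => k; apply: has_mean_sum => l; apply: has_meanZ.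
    exact: lratio_error_mean.
  apply: has_mean_sum => k; apply: has_mean_sum => k'; apply: has_mean_sum => l.
  apply: has_mean_sum => l'; apply: has_meanZ.
  exact: lratio_centered_covariance.
- by move=> w; exact: sqr_ge0.
move=> w; set X := xhat (aff M m0 (Z w)).
have L2Y : L2fun T0 (fun t => X t - h0 t) by apply: L2funB => //; exact: L2xhat.
pose V t := \sum_k q k w * dir k t.
have L2V : L2fun T0 V by exact: L2fun_sum.
have -> : \sum_k \sum_l A k l * (e k w * (L l w - 1)) =
    ip T0 V (fun t => X t - h0 t).
  rewrite /V ip_suml//; apply: eq_bigr => k _.
  have -> : ip T0 (dir k) (fun t => X t - h0 t) = e k w.
    by rewrite ipC ipBl//; exact: L2xhat.
  rewrite /q mulr_suml; apply: eq_bigr => l _; ring.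
have -> : \sum_k \sum_k' \sum_l \sum_l' A k l * A k' l' * ip T0 (dir k) (dir k') *
    ((L l w - 1) * (L l' w - 1)) = ip T0 V V.
  rewrite {1}/V ip_suml//; apply: eq_bigr => k _.
  rewrite /V ip_sumr// mulr_sumr; apply: eq_bigr => k' _.
  rewrite /q mulr_suml; apply: eq_bigr => l _.
  rewrite mulr_suml mulr_sumr; apply: eq_bigr => l' _; ring.
rewrite L2norm_sqr; move: (fun t => X t - h0 t) L2Y => Y L2Y.
have L2YV : L2fun T0 (fun t => Y t - V t) by exact: L2funB.
have := ip_ge0 T0 (fun t => Y t - V t); rewrite ipBl//.
by rewrite ![ip T0 _ (fun t => _ - V t)]ipC !ipBl// (ipC T0 Y V); lra.
Qed.

End chapman_robbins.

(** * Definiteness of quadratic forms *)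

Section quadratic_forms.
Context {R : realFieldType}.

Lemma sum_sqr_eq0 n (x : 'cV[R]_n) : (x^T *m x) ord0 ord0 = 0 -> x = 0.
Proof.
rewrite mxE => /eqP; rewrite psumr_eq0; last first.
  by move=> i _; rewrite mxE -expr2 sqr_ge0.
move=> /allP h; apply/colP => i; rewrite mxE; apply/eqP.
have := h i; rewrite mem_index_enum /= mxE -expr2 sqrf_eq0; exact.
Qed.

(** If the form vanishes at [x], its value at [x + t C x] is [2 t |C x|^2 + t^2 q]; nonnegativity
    for every [t] forces [C x = 0], hence [x = 0]. *)
Lemma psd_unit_pd n (C : 'M[R]_n) : C^T = C -> C \in unitmx ->
  (forall x : 'cV[R]_n, 0 <= (x^T *m C *m x) ord0 ord0) ->
  forall x : 'cV[R]_n, x != 0 -> 0 < (x^T *m C *m x) ord0 ord0.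
Proof.
move=> Cs Cu psd x x0; rewrite lt_neqAle psd andbT eq_sym.
apply: contra x0 => /eqP q0; set y := C *m x.
set p := (y^T *m y) ord0 ord0; set q := (y^T *m C *m y) ord0 ord0.
have q_ge0 : 0 <= q by exact: psd.
have expand t : 0 <= 2 * t * p + t ^+ 2 * q.
  have e1 : x^T *m C *m y = y^T *m y by rewrite /y trmx_mul Cs.
  have e2 : y^T *m C *m x = y^T *m y by rewrite -mulmxA.
  have -> : 2 * t * p + t ^+ 2 * q = ((x + t *: y)^T *m C *m (x + t *: y)) ord0 ord0.
    have -> : (x + t *: y)^T = x^T + t *: y^T by rewrite linearD linearZ.
    rewrite !mulmxDl !mulmxDr -!scalemxAl -!scalemxAr e1 e2.
    rewrite /p /q; move: (y^T *m y) (y^T *m C *m y) (x^T *m C *m x) q0 => A B E E0.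
    by rewrite !mxE E0; ring.
  exact: psd.
have p0 : p = 0.
  (* The [+ 1] keeps the denominator positive when [q = 0]. *)
  have := expand (- p / (q + 1)).
  have q1 : 0 < q + 1 by lra.
  have -> : 2 * (- p / (q + 1)) * p + (- p / (q + 1)) ^+ 2 * q =
      - (p ^+ 2 * ((q + 2) / (q + 1) ^+ 2)) by field; rewrite gt_eqF.
  rewrite oppr_ge0 => h; apply/eqP; rewrite -sqrf_eq0 eq_le sqr_ge0 andbT.
  by move: h; rewrite pmulr_lle0// divr_gt0 ?exprn_gt0//; lra.
by rewrite -(mulKmx Cu x) -/y (sum_sqr_eq0 _ _ p0) mulmx0.
Qed.

End quadratic_forms.

(** * Fréchet differentiability seen through inner products *)

Section frechet_inner_product.
Context {R : realType} (T0 : R) (K : nat).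
Variables (Theta : set 'rV[R]_K) (h : 'rV[R]_K -> R -> R) (th : 'rV[R]_K).
Variable D : 'I_K -> R -> R.
Hypotheses (oTheta : open Theta) (Th : Theta th).
Hypothesis L2h : forall t, Theta t -> L2fun T0 (h t).
Hypothesis L2D : forall k, L2fun T0 (D k).
Hypothesis dh : frechet_L2 T0 h th D.

Lemma open_norm : exists2 r, 0 < r & forall dl : 'rV[R]_K, `|dl| < r -> Theta (th + dl).
Proof.
have : nbhs th Theta by apply: open_nbhs_nbhs; split.
move=> /nbhs_normP[r /= r0 hr]; exists r => // dl dr; apply: hr.
by rewrite /ball_ /= opprD addrA subrr add0r normrN.
Qed.

(** Cauchy-Schwarz against [g] reduces the expansion in L2 to a scalar one. It serves with [g] a
    kernel, for the mean of the samples, and with [g] a partial derivative, for the error bound. The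
    [+ 1] added to the norm of [g] covers norm 0. *)
Lemma frechet_ip_expansion g : L2fun T0 g ->
  forall eps, 0 < eps -> exists2 r, 0 < r & forall dl : 'rV[R]_K, `|dl| < r ->
    `|ip T0 (h (th + dl)) g - ip T0 (h th) g - lform (fun k => ip T0 (D k) g) dl| <=
    eps * `|dl|.
Proof.
move=> L2g eps eps0; have N0 : 0 <= L2norm T0 g by exact: sqrtr_ge0.
have e0 : 0 < eps / (L2norm T0 g + 1) by rewrite divr_gt0//; lra.
have [r1 r10 hr1] := open_norm; have [r2 r20 hr2] := dh _ e0.
exists (Num.min r1 r2); first by rewrite lt_min r10.
move=> dl; rewrite lt_min => /andP[/hr1 Tdl /hr2 hdl].
have L2l : L2fun T0 (linmap D dl) by exact: L2fun_sum.
have L2a := L2funB _ _ _ (L2h _ Tdl) (L2h _ Th).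
have <- : ip T0 (fun t => h (th + dl) t - h th t - linmap D dl t) g =
    ip T0 (h (th + dl)) g - ip T0 (h th) g - lform (fun k => ip T0 (D k) g) dl.
  rewrite ipBl// ipBl//; [|exact: L2h|exact: L2h].
  by congr (_ - _); rewrite /linmap ip_suml.
apply: le_trans (ip_norm_le _ _ _ _ _) _ => //; first exact: L2funB.
apply: le_trans (ler_wpM2r N0 hdl) _.
set G := L2norm T0 g in N0 *.
have -> : eps / (G + 1) * `|dl| * G = eps * `|dl| * (G / (G + 1)).
  by field; rewrite gt_eqF//; lra.
by rewrite ler_piMr ?mulr_ge0 ?(ltW eps0)// ler_pdivrMr; lra.
Qed.

Lemma expansion_quotient (f : 'rV[R]_K -> R) (a : 'I_K -> R) l :
  (forall eps, 0 < eps -> exists2 r, 0 < r & forall dl : 'rV[R]_K, `|dl| < r ->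
     `|f (th + dl) - f th - lform a dl| <= eps * `|dl|) ->
  (n.+1%:R * (f (th + n.+1%:R^-1 *: evec l) - f th)) @[n --> \oo] --> a l.
Proof.
move=> hf; apply/cvgrPdist_le => eps eps0; set c := `|evec l : 'rV[R]_K|.
have c0 : 0 <= c by exact: normr_ge0.
have e0 : 0 < eps / (c + 1) by rewrite divr_gt0//; lra.
have [r r0 hr] := hf _ e0.
have : c * harmonic n @[n --> \oo] --> (c * 0 : R).
  by apply: cvgMr; exact: cvg_harmonic.
rewrite mulr0 => /cvgr0Pnorm_lt/(_ r r0); apply: filterS => n hn.
have n0 : 0 < n.+1%:R :> R by [].
have nV0 : 0 <= n.+1%:R^-1 :> R by rewrite invr_ge0.
have nE : `|n.+1%:R^-1 *: (evec l : 'rV[R]_K)| = n.+1%:R^-1 * c.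
  by rewrite normrZ ger0_norm.
have := hr (n.+1%:R^-1 *: evec l); rewrite nE [lform _ _]linearZ /= lform_evec.
have -> : n.+1%:R^-1 * c < r.
  by apply: le_lt_trans hn; rewrite mulrC; exact: ler_norm.
move=> /(_ isT) hl.
have -> : a l - n.+1%:R * (f (th + n.+1%:R^-1 *: evec l) - f th) =
    - (n.+1%:R * (f (th + n.+1%:R^-1 *: evec l) - f th - n.+1%:R^-1 * a l)).
  by field; rewrite gt_eqF.
rewrite normrN normrM (ger0_norm (ltW n0)).
apply: le_trans (ler_wpM2l (ltW n0) hl) _.
have -> : n.+1%:R * (eps / (c + 1) * (n.+1%:R^-1 * c)) = eps * (c / (c + 1)).
  by field; rewrite !gt_eqF//; lra.
by rewrite ler_piMr ?(ltW eps0)// ler_pdivrMr; lra.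
Qed.

End frechet_inner_product.

(** * Whitening the sampled noise *)

Section sampling_model.
Context {R : realType} (T0 : R) (d : measure_display) (T : measurableType d).
Variables (P : probability T R) (W : (R -> R) -> T -> R) (sigc2 sigd2 : R).
Variables (N : nat) (s : 'I_N -> R -> R) (v : 'I_N -> T -> R).
Hypothesis sigc2_ge0 : 0 <= sigc2.
Hypothesis hW : white_noise P T0 sigc2 W.
Hypothesis hs : forall n, L2fun T0 (s n).
Hypothesis hv : forall n, is_gaussian P (v n) 0 sigd2.
Hypothesis iv : mutually_indep P v.
Hypothesis ivW : indep_of_noise P T0 v W.

Let C : 'M[R]_N := sigc2 *: (\matrix_(i, j) ip T0 (s i) (s j)) + sigd2%:M.

Lemma sampled_cov_sym : C^T = C.
Proof.
rewrite /C linearD linearZ /= tr_scalar_mx; congr (_ *: _ + _).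
by apply/matrixP => i j; rewrite !mxE ipC.
Qed.

Lemma sampled_cov_qform (b : 'cV[R]_N) : (b^T *m C *m b) ord0 ord0 =
  sigc2 * ip T0 (fun t => \sum_i b i ord0 * s i t) (fun t => \sum_i b i ord0 * s i t) +
  sigd2 * \sum_i b i ord0 ^+ 2.
Proof.
rewrite /C mulmxDr mulmxDl -scalemxAr -scalemxAl mul_mx_scalar -scalemxAl.
rewrite ip_suml//; last exact: L2fun_sum.
rewrite mxE; congr (_ + _); rewrite mxE; congr (_ * _); rewrite mxE.
  apply: eq_bigr => i _; rewrite mxE mulrC ip_sumr//; congr (_ * _).
  by apply: eq_bigr => j _; rewrite !mxE ipC.
by apply: eq_bigr => i _; rewrite mxE expr2.
Qed.

Lemma sampled_cov_psd (b : 'cV[R]_N) : 0 <= (b^T *m C *m b) ord0 ord0.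
Proof.
rewrite sampled_cov_qform; apply: addr_ge0; first by rewrite mulr_ge0 ?ip_ge0.
rewrite mulr_sumr; apply: sumr_ge0 => i _.
by have [_ [? _]] := hv i; rewrite mulr_ge0 ?sqr_ge0.
Qed.

(** [Z] is [M^-1] applied to the noise vector. Its generating function at [a] is that of the noise
    at [b = M^-T a], and [b^T C b = |a|^2] because [C = M M^T]. *)
Lemma whitening : C \in unitmx -> exists (M : 'M[R]_N) (Z : T -> N.-tuple R),
  [/\ M \in unitmx, C = M *m M^T, measurable_fun setT Z,
    forall a : 'I_N -> R, (\int[P]_w (expR (\sum_i a i * tnth (Z w) i))%:E =
      (expR (\sum_i a i ^+ 2 / 2))%:E)%E &
    forall (m : 'I_N -> R) w, [tuple m n + W (s n) w + v n w | n < N] =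
      aff M (\col_n m n) (Z w)].
Proof.
move=> Cu.
have [M Mu CE] := cholesky _ C sampled_cov_sym
  (psd_unit_pd _ _ sampled_cov_sym Cu sampled_cov_psd).
pose Y w := [tuple W (s n) w + v n w | n < N].
exists M, (fun w => aff (invmx M) 0 (Y w)); split => //.
- apply: measurableT_comp; first exact: measurable_aff.
  apply/measurable_fun_tnthP => i.
  rewrite (_ : _ \o _ = fun w => W (s i) w + v i w); last first.
    by apply/funext => w /=; rewrite tnth_mktuple.
  apply: measurable_funD; last by case: (hv i).
  by case: (white_noise_gaussian T0 _ _ _ _ _ hW _ (hs i)).
- move=> a; pose b : 'cV[R]_N := (invmx M)^T *m (\col_i a i).
  have -> : (fun w => (expR (\sum_i a i * tnth (aff (invmx M) 0 (Y w)) i))%:E) =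
      (fun w => (expR (\sum_i b i ord0 * (W (s i) w + v i w)))%:E).
    apply/funext => w; congr (expR _)%:E.
    transitivity (((\col_i a i)^T *m (invmx M *m colv (Y w))) ord0 ord0).
      rewrite mxE; apply: eq_bigr => i _; rewrite tnth_mktuple addr0 !mxE.
      by congr (_ * _).
    rewrite mulmxA -[(\col_i a i)^T *m _]trmxK trmx_mul trmxK -/b mxE.
    by apply: eq_bigr => i _; rewrite !mxE tnth_mktuple.
  rewrite (sampled_noise_mgf T0 _ _ _ _ _ hW _ _ _ _ hs hv iv ivW (fun i => b i ord0)).
  rewrite -sampled_cov_qform CE /b trmx_mul trmxK; congr (expR _)%:E.
  rewrite !mulmxA -[_ *m invmx M *m M]mulmxA mulVmx// mulmx1.
  rewrite -[_ *m M^T *m _]mulmxA -trmx_mul mulVmx// trmx1 mulmx1 mxE.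
  by rewrite mulr_suml; apply: eq_bigr => i _; rewrite !mxE expr2.
move=> m w; apply: colv_inj; rewrite !colv_aff addr0 mulKVmx//.
by apply/colP => i; rewrite !mxE !tnth_mktuple addrC addrA.
Qed.

End sampling_model.

(** * Limit of small increments and the trace bound *)

Section cramer_rao_limit.
Context {R : realType}.

Lemma cvg_sumr n (f : 'I_n -> nat -> R) (a : 'I_n -> R) :
  (forall i, f i j @[j --> \oo] --> a i) ->
  (\sum_i f i j) @[j --> \oo] --> \sum_i a i.
Proof.
by move=> fa; apply: cvg_big => // x; exact: add_continuous.
Qed.

(** [x <= expR x - 1 <= x * expR x] for either sign of [x], and the hypothesis forces [x j] to tend
    to 0. *)
Lemma cvg_expR_quotient (x : nat -> R) (y : R) :
  (j.+1%:R ^+ 2 * x j) @[j --> \oo] --> y ->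
  (j.+1%:R ^+ 2 * (expR (x j) - 1)) @[j --> \oo] --> y.
Proof.
move=> xy.
have x0 : x j @[j --> \oo] --> (0 : R).
  have -> : x = fun j => harmonic j * (harmonic j * (j.+1%:R ^+ 2 * x j)).
    by apply/funext => j; rewrite /harmonic /=; field.
  rewrite -(mul0r (0 * y)); apply: cvgM; first exact: cvg_harmonic.
  by apply: cvgM => //; exact: cvg_harmonic.
apply: (@squeeze_cvgr _ _ _ _ (fun j => j.+1%:R ^+ 2 * x j)
  (fun j => j.+1%:R ^+ 2 * x j * expR (x j))) => //.
- apply: nearW => j; rewrite -mulrA !ler_pM2l ?exprn_gt0//.
  have h1 := expR_ge1Dx (x j); have h2 := expR_ge1Dx (- x j).
  have ep := expR_gt0 (x j).
  have := ler_wpM2l (ltW ep) h2; rewrite -expRD subrr expR0.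
  by move=> h3; apply/andP; split; nra.
- rewrite -[y]mulr1 -[in X in _ --> X]expR0; apply: cvgM => //.
  by apply: continuous_cvg => //; exact: continuous_expR.
Qed.

Lemma ereal_ge_limit (f : nat -> R) (l : R) (x : \bar R) : f j @[j --> \oo] --> l ->
  (\forall j \near \oo, ((f j)%:E <= x)%E) -> (l%:E <= x)%E.
Proof.
move=> fl; case: x => [r||]; last 2 first.
- by move=> _; rewrite leey.
- by move=> h; have [j] := @filter_ex _ \oo _ _ h.
move=> h; rewrite lee_fin; apply: (cvgr_to_le fl).
by apply: filterS h => j; rewrite lee_fin.
Qed.

Variables (T0 : R) (d : measure_display) (T : measurableType d).
Variables (P : probability T R) (n K : nat) (Z : T -> n.-tuple R).
Hypothesis mZ : measurable_fun setT Z.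
Hypothesis mgfZ : forall a : 'I_n -> R,
  (\int[P]_w (expR (\sum_i a i * tnth (Z w) i))%:E =
   (expR (\sum_i a i ^+ 2 / 2))%:E)%E.
Variables (M : 'M[R]_n) (Mu : M \in unitmx).
Variables (m0 : 'cV[R]_n) (m1 : nat -> 'I_K -> 'cV[R]_n).
Variables (h0 : R -> R) (h1 : nat -> 'I_K -> R -> R) (dir : 'I_K -> R -> R).
Variable xhat : n.-tuple R -> R -> R.
Hypotheses (L2h0 : L2fun T0 h0) (L2dir : forall k, L2fun T0 (dir k)).
Hypothesis L2xhat : forall y, L2fun T0 (xhat y).
Hypothesis mxhat : forall g, L2fun T0 g ->
  measurable_fun setT (fun y => ip T0 (xhat y) g).
Hypothesis unbiased0 : forall g, L2fun T0 g ->
  has_mean _ _ P (fun w => ip T0 (xhat (aff M m0 (Z w))) g) (ip T0 h0 g).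
Hypothesis unbiased1 : \forall j \near \oo, forall l g, L2fun T0 g ->
  has_mean _ _ P (fun w => ip T0 (xhat (aff M (m1 j l) (Z w))) g) (ip T0 (h1 j l) g).
Variable SD : 'M[R]_(n, K).
Hypothesis dh1 : forall k l,
  (j.+1%:R * (ip T0 (h1 j l) (dir k) - ip T0 h0 (dir k))) @[j --> \oo] -->
  ip T0 (dir l) (dir k).
Hypothesis dm1 : forall i l,
  (j.+1%:R * (m1 j l - m0) i ord0) @[j --> \oo] --> SD i l.

Let B := invmx M *m SD.
Let u j l := invmx M *m (m1 j l - m0).

Lemma whitened_quotient i l : (j.+1%:R * u j l i ord0) @[j --> \oo] --> B i l.
Proof.
rewrite /B mxE (_ : (fun j => _) =
    fun j => \sum_q invmx M i q * (j.+1%:R * (m1 j l - m0) q ord0)); last first.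
  apply/funext => j; rewrite /u mxE mulr_sumr; apply: eq_bigr => q _; ring.
by apply: cvg_sumr => q; apply: cvgMr; exact: dm1.
Qed.

Lemma lratio_covariance_quotient l l' :
  (j.+1%:R ^+ 2 * (expR (\sum_i u j l i ord0 * u j l' i ord0) - 1)) @[j --> \oo] -->
  (B^T *m B) l l'.
Proof.
apply: cvg_expR_quotient; rewrite mxE.
rewrite (_ : (fun j => _) = fun j => \sum_i
    (j.+1%:R * u j l i ord0) * (j.+1%:R * u j l' i ord0)); last first.
  apply/funext => j; rewrite mulr_sumr; apply: eq_bigr => q _; ring.
by apply: cvg_sumr => q; rewrite mxE; apply: cvgM; exact: whitened_quotient.
Qed.

Lemma cramer_rao_matrix (A : 'M[R]_K) :
  ((2 * (\sum_k \sum_l A k l * ip T0 (dir l) (dir k)) -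
    \sum_k \sum_k' \sum_l \sum_l' A k l * A k' l' * ip T0 (dir k) (dir k') *
      (B^T *m B) l l')%:E <=
   \int[P]_w (L2norm T0 (fun t => xhat (aff M m0 (Z w)) t - h0 t) ^+ 2)%:E)%E.
Proof.
pose F j := 2 * (\sum_k \sum_l A k l * (j.+1%:R * (ip T0 (h1 j l) (dir k) - ip T0 h0 (dir k)))) -
    \sum_k \sum_k' \sum_l \sum_l' A k l * A k' l' * ip T0 (dir k) (dir k') *
      (j.+1%:R ^+ 2 * (expR (\sum_i u j l i ord0 * u j l' i ord0) - 1)).
apply: (@ereal_ge_limit F).
  rewrite /F; apply: cvgB; first apply: cvgMr.
    by apply: cvg_sumr => k; apply: cvg_sumr => l; apply: cvgMr; exact: dh1.
  apply: cvg_sumr => k; apply: cvg_sumr => k'; apply: cvg_sumr => l.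
  apply: cvg_sumr => l'; apply: cvgMr; exact: lratio_covariance_quotient.
apply: filterS unbiased1 => j ub.
(* Scaling [A] by [j.+1] gives the factor [j.+1] to the first-order increments of [h] and its square
   to the covariances, which are of second order. *)
apply: le_trans (chapman_robbins_bound T0 _ _ P n K Z mZ mgfZ M Mu m0 (m1 j) h0 (h1 j)
  dir xhat L2h0 L2dir L2xhat mxhat unbiased0 ub (j.+1%:R *: A)).
rewrite lee_fin le_eqVlt; apply/orP; left; apply/eqP; congr (2 * _ - _).
  apply: eq_bigr => k _; apply: eq_bigr => l _; rewrite !mxE; ring.
apply: eq_bigr => k _; apply: eq_bigr => k' _; apply: eq_bigr => l _.
apply: eq_bigr => l' _; rewrite [(_ *: A) k l]mxE [(_ *: A) k' l']mxE /u; ring.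
Qed.

(** At [A = J^-1], the choice that maximises the bound over [A], the linear and the quadratic sum
    are both equal to the trace [t], leaving [2 t - t]. *)
Lemma cramer_rao_trace (DD := \matrix_(k, l) ip T0 (dir k) (dir l) : 'M[R]_K) :
  B^T *m B \in unitmx ->
  ((\tr (DD *m invmx (B^T *m B)))%:E <=
   \int[P]_w (L2norm T0 (fun t => xhat (aff M m0 (Z w)) t - h0 t) ^+ 2)%:E)%E.
Proof.
set J := B^T *m B => Ju; have Js : J^T = J by rewrite /J trmx_mul trmxK.
have JVs : (invmx J)^T = invmx J by rewrite trmx_inv Js.
have := cramer_rao_matrix (invmx J); rewrite -/J.
have -> : \sum_k \sum_l invmx J k l * ip T0 (dir l) (dir k) = \tr (DD *m invmx J).
  rewrite mxtrace_mulC /mxtrace; apply: eq_bigr => k _; rewrite mxE.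
  by apply: eq_bigr => l _; rewrite /DD [in RHS]mxE.
have -> : \sum_k \sum_k' \sum_l \sum_l' invmx J k l * invmx J k' l' *
    ip T0 (dir k) (dir k') * J l l' = \tr (DD *m invmx J).
  have JE : invmx J = invmx J *m J *m (invmx J)^T by rewrite mulVmx// mul1mx JVs.
  have J_sym l l' : J l l' = J l' l by rewrite -[in LHS]Js mxE.
  rewrite [in RHS]JE /mxtrace; apply: eq_bigr => k _.
  rewrite [in RHS]mxE; apply: eq_bigr => k' _.
  rewrite [DD k k']mxE [in RHS]mxE mulr_sumr; apply: eq_bigr => l _.
  rewrite [X in _ * (X * _)]mxE [(invmx J)^T _ _]mxE mulr_suml mulr_sumr.
  by apply: eq_bigr => l' _; rewrite (J_sym l l'); ring.
by congr (_%:E <= _)%E; ring.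
Qed.

End cramer_rao_limit.

Theorem theorem3 (R : realType) (T0 : R) (K N : nat)
  (Theta : set 'rV[R]_K)
  (h : 'rV[R]_K -> R -> R)                 (* theta |-> h_theta *)
  (D : 'rV[R]_K -> 'I_K -> R -> R)         (* D_theta e_k = D theta k *)
  (s : 'I_N -> R -> R)                     (* sampling kernels s_1..s_N *)
  (sigc2 sigd2 : R)                        (* sigma_c^2, sigma_d^2 *)
  (d : measure_display) (Omega : measurableType d) (P : probability Omega R)
  (W : (R -> R) -> Omega -> R)             (* f |-> <f, w> *)
  (v : 'I_N -> Omega -> R)                 (* discrete noise v_1..v_N *)
  (theta : 'rV[R]_K) :
  0 < T0 ->
  open Theta ->
  (forall th, Theta th -> L2fun T0 (h th)) ->
  (forall th, Theta th -> forall k, L2fun T0 (D th k)) ->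
  (* (P6) *)
  (forall th, Theta th -> frechet_L2 T0 h th (D th)) ->
  (* (P7) *)
  (forall th, Theta th -> forall delta : 'rV[R]_K,
      L2norm T0 (linmap (D th) delta) = 0 -> delta = 0) ->
  Theta theta ->
  (forall n, L2fun T0 (s n)) ->
  0 <= sigc2 -> white_noise P T0 sigc2 W ->
  (forall n, is_gaussian P (v n) 0 sigd2) ->
  mutually_indep P v ->
  indep_of_noise P T0 v W ->
  let G : 'M[R]_N := \matrix_(i < N, j < N) ip T0 (s i) (s j) in  (* S^* S *)
  let C : 'M[R]_N := sigc2 *: G + sigd2%:M in
  C \in unitmx ->
  (* measurements c_n = <h_theta' + w, s_n> + v_n *)
  let c : 'rV[R]_K -> Omega -> N.-tuple R := fun th w =>
    [tuple ip T0 (h th) (s n) + W (s n) w + v n w | n < N] in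
  let SD : 'M[R]_(N, K) := \matrix_(n < N, k < K) ip T0 (D theta k) (s n) in
                                                               (* S^* D_theta *)
  let DD : 'M[R]_K := \matrix_(k < K, l < K) ip T0 (D theta k) (D theta l) in
                                                             (* D^* D_theta *)
  let Jsamp : 'M[R]_K := SD^T *m invmx C *m SD in
  fisher_info P Theta c theta Jsamp /\
  ((forall delta : 'rV[R]_K,
      (forall n, ip T0 (linmap (D theta) delta) (s n) = 0) ->
      L2norm T0 (linmap (D theta) delta) = 0) ->
   Jsamp \in unitmx /\
   forall xhat : N.-tuple R -> R -> R,
     (forall y, L2fun T0 (xhat y)) ->
     (forall g, L2fun T0 g -> measurable_fun setT (fun y => ip T0 (xhat y) g)) ->
     (* unbiased (weak expectation) *)
     (forall th, Theta th -> forall g, L2fun T0 g ->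
        P.-integrable setT (fun w => (ip T0 (xhat (c th w)) g)%:E) /\
        ('E_P[fun w => ip T0 (xhat (c th w)) g] = (ip T0 (h th) g)%:E)%E) ->
     (* finite second moment *)
     ('E_P[fun w => (L2norm T0 (xhat (c theta w)) ^+ 2)%R] < +oo)%E ->
     ((\tr (DD *m invmx Jsamp))%:E <=
        'E_P[fun w => (L2norm T0 (fun t => xhat (c theta w) t - h theta t) ^+ 2)%R])%E).
Proof.
move=> T0_gt0 oTheta L2h L2D dh injD Th hs sigc2_ge0 hW hv iv ivW G C Cu c SD DD Jsamp.
have [M [Z [Mu CE mZ mgfZ cZ]]] :=
  whitening T0 _ _ P W sigc2 sigd2 N s v sigc2_ge0 hW hs hv iv ivW Cu.
pose m th : 'cV[R]_N := \col_n ip T0 (h th) (s n).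
have cE : c = fun th w => aff M (m th) (Z w).
  by apply/funext => th; apply/funext => w; rewrite /c cZ.
have ipE := frechet_ip_expansion T0 K Theta h theta (D theta) oTheta Th L2h
  (L2D _ Th) (dh _ Th).
set B := invmx M *m SD.
have JB : Jsamp = B^T *m B by rewrite /Jsamp [C]CE whitened_gram.
split.
  rewrite cE /Jsamp [C]CE; apply: gaussian_model_fisher => // i x.
  have -> : (fun t => m t i ord0) = fun t => ip T0 (h t) (s i).
    by apply/funext => t; rewrite mxE.
  have -> : lform (SD i) x = lform (fun k => ip T0 (D theta k) (s i)) x.
    by apply: eq_bigr => k _; rewrite mxE.
  by apply: diff_of_expansion; exact: ipE.
move=> sep.
(* If [x J = 0] then [|B x^T|^2 = x J x^T = 0], so the derivative in direction [x] is orthogonal to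
   all kernels; it vanishes by the range condition, and [x = 0] by injectivity. *)
have Ju : Jsamp \in unitmx.
  rewrite -row_free_unit; apply/inj_row_free => x xJ.
  apply: (injD _ Th); apply: sep => n.
  have Bx : B *m x^T = 0.
    apply: sum_sqr_eq0; rewrite trmx_mul trmxK.
    have -> : x *m B^T *m (B *m x^T) = x *m Jsamp *m x^T by rewrite JB !mulmxA.
    by rewrite xJ mul0mx mxE.
  have SDx : SD *m x^T = 0
    by rewrite -(mulKVmx Mu (SD *m x^T)) [invmx M *m _]mulmxA -/B Bx mulmx0.
  rewrite /linmap ip_suml//; last exact: L2D.
  move: SDx => /matrixP/(_ n ord0); rewrite !mxE => SDx; rewrite -[RHS]SDx.
  by apply: eq_bigr => k _; rewrite !mxE mulrC.
split => // xhat L2xhat mxhat unb _.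
have unb' th : Theta th -> forall g, L2fun T0 g ->
    has_mean _ _ P (fun w => ip T0 (xhat (aff M (m th) (Z w))) g) (ip T0 (h th) g).
  by move=> Tth g L2g; have := unb _ Tth _ L2g; rewrite expectation.unlock cE.
pose th1 j l := theta + j.+1%:R^-1 *: evec l.
(* The perturbed parameters lie in [Theta] only for small steps. The sum of the norms of the basis
   vectors makes the threshold uniform in [l]. *)
have Tth1 : \forall j \near \oo, forall l, Theta (th1 j l).
  have [r r0 hr] := open_norm K Theta theta oTheta Th.
  have : harmonic j * (\sum_l `|evec l : 'rV[R]_K|) @[j --> \oo] --> (0 : R).
    rewrite -[X in _ --> X](mul0r (\sum_l `|evec l : 'rV[R]_K|)).
    by apply: cvgMl; exact: cvg_harmonic.
  move=> /cvgr0Pnorm_lt/(_ r r0); apply: filterS => j hj l; apply: hr.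
  apply: le_lt_trans hj; rewrite normrZ normrM; apply: ler_wpM2l => //.
  apply: le_trans (ler_norm _); rewrite (bigD1 l)//= lerDl.
  by apply: sumr_ge0.
rewrite JB expectation.unlock cE.
apply: (cramer_rao_trace T0 _ _ P N K Z mZ mgfZ M Mu (m theta)
  (fun j l => m (th1 j l)) (h theta) (fun j l => h (th1 j l)) (D theta) xhat) => //.
- exact: L2h.
- exact: L2D.
- exact: unb'.
- by apply: filterS Tth1 => j Tj l; exact: unb'.
- move=> k l; apply: (expansion_quotient K theta (fun t => ip T0 (h t) (D theta k))
    (fun q => ip T0 (D theta q) (D theta k))).
  by apply: ipE; exact: L2D.
- move=> i l; rewrite (_ : (fun j => _) = fun j => j.+1%:R *
    (ip T0 (h (th1 j l)) (s i) - ip T0 (h theta) (s i))); last first.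
    by apply/funext => j; rewrite !mxE.
  rewrite [SD i l]mxE.
  apply: (expansion_quotient K theta (fun t => ip T0 (h t) (s i))
    (fun q => ip T0 (D theta q) (s i))).
  exact: ipE.
- by rewrite -JB.
Qed.
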